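(* Suppose $\dim(Y)<\infty$, and let the kernel assumption and the assumptions on $A$ and $\phi$ listed in the context hold. Let $\Psi(t)=t^{\frac12+\frac1{2b}}\phi(t)$. Then, for samples $\mathbf z\in Z^m$ drawn i.i.d. from $\rho$, $$\lim_{\tau\to0}\liminf_{m\to\infty}\inf_{l\in\mathcal A}\sup_{\rho\in\mathcal P_{\phi,b}}\mathbb P_{\mathbf z\in Z^m}\left\{\|f_{\mathbf z}^l-f_\rho\|_{\mathcal H_1}>\tau\,\phi\left(\Psi^{-1}(m^{-1/2})\right)\right\}=1,$$ where $\mathcal A$ denotes the set of all learning algorithms $l:\mathbf z\mapsto f_{\mathbf z}^l\in\mathcal H_1$.
   Context: Setting. $X$ is a Polish space, $Y$ a real separable Hilbert space, $Z=X\times Y$. $\mathcal H_1,\mathcal H_2$ are real separable Hilbert spaces, $A:\mathcal D(A)\subset\mathcal H_1\to\mathcal H_2$ is a (non-linear) map, $\bar f\in\mathcal H_1$ is a fixed initial guess. A learning algorithm is any rule $l$ assigning to every sample $\mathbf z\in Z^m$ an element $f_{\mathbf z}^l\in\mathcal H_1$. A probability measure $\rho$ on $Z$ has marginal $\rho_X$ and conditional distribution $\rho(y|x)$. Kernel assumption. $\mathcal H_2$ is a vector-valued reproducing kernel Hilbert space of functions $X\to Y$ with operator-valued positive semi-definite kernel $K:X\times X\to\mathcal L(Y)$; $K_x:Y\to\mathcal H_2$, $(K_xy)(z)=K(z,x)y$, and $f(x)=K_x^*f$. Each $K_x$ is Hilbert-Schmidt, $\kappa^2:=\sup_{x}\operatorname{tr}(K_x^*K_x)<\infty$,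 and $(x,t)\mapsto\langle K_tv,K_xw\rangle_{\mathcal H_2}$ is measurable for all $v,w\in Y$. For a probability measure $\nu$ on $X$, $I_K:\mathcal H_2\to\mathscr L^2(X,\nu;Y)$ is the canonical injection, and $L_K=I_K^*I_K$. Assumptions on $A$ and $\phi$. Here $I_K$ is taken with respect to a probability measure $\nu$ on $X$ (the marginal distribution). $\mathcal B_\delta(\bar f)$ is a (sufficiently large) ball around $\bar f$ of radius $\delta>0$. (i) $A$ is Fréchet differentiable. (ii) $\|A'(\bar f)\|_{\mathcal H_1\to\mathcal H_2}\le L<\infty$. (iii) There is $\gamma\ge0$ such that $\|I_K\{A'(\tilde f)-A'(f)\}\|_{HS}\le\gamma\|\tilde f-f\|_{\mathcal H_1}$ for all $f,\tilde f\in\mathcal D(A)\cap\mathcal B_\delta(\bar f)$ ($HS$: Hilbert-Schmidt norm). (iv) $\phi$ is a continuous increasing function with $\phi(0)=0$, and $\theta(t)=\phi(t^2)$ is Lipschitz continuous with constant $L_\theta$. For $T_f=A'(f)^*I_K^*I_KA'(f)$ and $\overline T=A'(\bar f)^*I_K^*I_KA'(\bar f)$ there are bounded linear operators $R_f:\mathcal H_1\to\mathcal H_1$, $f\in\mathcal B_\delta(\bar f)$, and a constant $\zeta>0$ with $\phi(T_f)=R_f\,\phi(\overline T)$ and $\|R_f-I\|_{\mathcal L(\mathcal H_1)}\le\zeta\|f-\bar f\|_{\mathcal H_1}$ for all $f\in\mathcal B_\delta(\bar f)$. (v) The eigenvalues $(t_n)_{n\in\mathbb N}$ of $\overline T$ satisfy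 $\alpha n^{-b}\le t_n\le\beta n^{-b}$ for all $n\in\mathbb N$, for fixed constants $\alpha,\beta>0$ and $b>1$. Class $\mathcal P_{\phi,b}$. For fixed $M,\Sigma,R>0$, $\beta>0$, $b>1$ and $\phi$, $\mathcal P_{\phi,b}$ is the class of probability measures $\rho$ on $Z$ such that: there is $f_\rho\in\mathrm{int}(\mathcal D(A))$ with $\int_Yy\,d\rho(y|x)=A(f_\rho)(x)$ for all $x\in X$ (true solution); for almost all $x\in X$, $\int_Y\left(e^{\|y-A(f_\rho)(x)\|_Y/M}-\frac{\|y-A(f_\rho)(x)\|_Y}{M}-1\right)d\rho(y|x)\le\frac{\Sigma^2}{2M^2}$ (noise condition); $f_\rho-\bar f=\phi(T)g$ for some $g\in\mathcal H_1$ with $\|g\|_{\mathcal H_1}\le R$, where $T=A'(f_\rho)^*I_K^*I_KA'(f_\rho)$ with $I_K$ taken with respect to $\rho_X$ (source condition); and the eigenvalues $(t_n)$ of $L_K$ (with respect to $\rho_X$) satisfy $t_n\le\beta n^{-b}$ for all $n$.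
   Formalization: The probability measure ν in the assumptions on A and φ is additionally required to be the marginal of some ρ in the class P_{φ,b}; without such a link the class can be empty and the claim fails. *)

(* Defs.v *)
From HB Require Import structures.
From mathcomp Require Import all_boot all_order all_algebra.
From mathcomp Require Import all_classical all_reals all_analysis.

Set Implicit Arguments.
Unset Strict Implicit.
Unset Printing Implicit Defensive.

Import Order.TTheory GRing.Theory Num.Theory.
Import numFieldNormedType.Exports.

Local Open Scope classical_set_scope.
Local Open Scope ring_scope.

HB.mixin Record CompleteNormedModule_isHilbert (R : realType) V
    & CompleteNormedModule R V := {
  inner : V -> V -> R ;
  innerC : forall u v, inner u v = inner v u ;
  innerDl : forall u v w, inner (u + v) w = inner u w + inner v w ;
  innerZl : forall a u v, inner (a *: u) v = a * inner u v ;
  inner_norm : forall u, inner u u = `|u| ^+ 2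
}.

#[short(type="hilbertType")]
HB.structure Definition Hilbert (R : realType) :=
  { V of CompleteNormedModule R V & CompleteNormedModule_isHilbert R V }.

Definition separable (T : topologicalType) :=
  exists2 D : set T, countable D & dense D.

Definition finite_dimensional (R : realType) (V : lmodType R) :=
  exists n (e : 'I_n -> V), forall v, exists c : 'I_n -> R,
    v = \sum_i c i *: e i.

Notation borel T := (g_sigma_algebraType (@open T)).

Section operators.
Context (R : realType).

(* The index set is nat in every (separable) dimension: in finite dimension all
   but finitely many of the [e n] are 0, which changes no sum over the basis. *)
Definition orthonormal_basis (H : hilbertType R) (e : nat -> H) :=
  [/\ forall i j, i <> j -> inner (e i) (e j) = 0,
      forall i, `|e i| = 1 \/ e i = 0 &
      forall v, (forall i, inner v (e i) = 0) -> v = 0].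

(* Squared Hilbert-Schmidt norm, computed in the orthonormal basis [e], of a
   linear map [S] into a space whose squared norm is [sqnorm]. *)
Definition hs_sqnorm (H : hilbertType R) (G : Type) (sqnorm : G -> \bar R)
    (S : H -> G) (e : nat -> H) : \bar R :=
  (\sum_(0 <= k <oo) sqnorm (S (e k)))%E.

Definition adjoint (H G : hilbertType R) (S : H -> G) : G -> H :=
  xget (fun=> 0) [set S' | forall u v, inner (S u) v = inner u (S' v)].

(* The nonzero [t n] are the nonzero eigenvalues of [T], in nonincreasing order
   and repeated according to multiplicity, with orthonormal eigenvectors [e n]:
   none is missing since [T] vanishes on the orthogonal complement of these
   eigenvectors. If [T] has finite rank, [t] ends with zeros, and the
   corresponding [e n] are irrelevant. *)
Definition eigensystem (H : hilbertType R) (T : H -> H)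
    (t : nat -> R) (e : nat -> H) :=
  [/\ (forall n, 0 <= t n) /\ {homo t : i j / (i <= j)%N >-> j <= i},
      forall n, t n != 0 -> T (e n) = t n *: e n,
      forall i j, t i != 0 -> t j != 0 -> inner (e i) (e j) = (i == j)%:R &
      forall v, (forall n, t n != 0 -> inner v (e n) = 0) -> T v = 0].

Definition eigenvalues (H : hilbertType R) (T : H -> H) (t : nat -> R) :=
  exists e, eigensystem T t e.

(* The spectral calculus phi(T) = \sum_k phi(t_k) <., e_k> e_k of a compact
   positive self-adjoint operator, for phi with phi(0) = 0. *)
Definition opfun (H : hilbertType R) (phi : R -> R) (T : H -> H) : H -> H :=
  xget (fun=> 0) [set S | exists t e, eigensystem T t e /\
    forall v, \sum_(0 <= k < n) (phi (t k) * inner v (e k)) *: e k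
      @[n --> \oo] --> S v].

End operators.

Section iid.
Context d (T : measurableType d) (R : realType).

Let tuple_cons m (p : T * m.-tuple T) : m.+1.-tuple T :=
  [the m.+1.-tuple T of p.1 :: p.2].

Let measurable_tuple_cons m : measurable_fun setT (@tuple_cons m).
Proof. exact: measurable_cons. Qed.

HB.instance Definition _ m :=
  isMeasurableFun.Build _ _ _ _ (@tuple_cons m) (@measurable_tuple_cons m).

(* The m-fold product measure of P, i.e. the law of m independent draws. *)
Fixpoint iid (P : probability T R) m : probability (m.-tuple T) R :=
  if m is m'.+1 then
    distribution (P \x iid P m')%E (@tuple_cons m' : {mfun _ >-> _})
  else \d_([tuple] : 0.-tuple T).

End iid.

HB.instance Definition _ d1 d2 (T1 : measurableType d1)
    (T2 : measurableType d2) :=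
  isMeasurableFun.Build _ _ _ _ (@fst T1 T2) measurable_fst.

Section rkhs.
Context (R : realType) (X : completePseudoMetricType R).
Context (Y H2 : hilbertType R).

(* [ev h] is the function X -> Y that the element [h] of H2 is, and
   [K_ x y] is K_x y. *)
Record kernel_assumption (ev : H2 -> X -> Y) (K : X -> X -> Y -> Y)
    (K_ : X -> Y -> H2) : Prop := {
  ev_linear : forall x, linear (fun h => ev h x) ;
  ev_injective : injective ev ;
  kernel_bounded : forall x z, linear (K x z) /\ continuous (K x z) ;
  kernel_adjoint : forall x z u v, inner (K x z u) v = inner u (K z x v) ;
  kernel_psd : forall n (x : 'I_n -> X) (y : 'I_n -> Y),
    0 <= \sum_i \sum_j inner (K (x i) (x j) (y j)) (y i) ;
  kernel_section : forall x y z, ev (K_ x y) z = K z x y ;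
  kernel_reproducing : forall x h y, inner (ev h x) y = inner h (K_ x y) ;
  (* tr(K_x^* K_x) is the squared Hilbert-Schmidt norm of K_x *)
  kernel_trace : exists2 e : nat -> Y, orthonormal_basis e &
    (ereal_sup (range (fun x =>
       hs_sqnorm (fun h : H2 => (`|h| ^+ 2)%:E) (K_ x) e)) < +oo)%E ;
  kernel_measurable : forall v w,
    measurable_fun setT (fun p : borel X * borel X =>
      inner (K_ p.2 v) (K_ p.1 w))
}.

(* L^2(X, nu; Y) is handled through representatives. *)
Definition L2_sqnorm (nu : probability (borel X) R) (u : X -> Y) : \bar R :=
  (\int[nu]_x (`|u x| ^+ 2)%:E)%E.

Definition L2 (nu : probability (borel X) R) : set (X -> Y) :=
  [set u | measurable_fun setT (u : borel X -> borel Y) /\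
           (L2_sqnorm nu u < +oo)%E].

Variable ev : H2 -> X -> Y.

Definition IK (h : H2) : X -> Y := ev h.

(* Characterized on L2 only. *)
Definition IK_adjoint (nu : probability (borel X) R) : (X -> Y) -> H2 :=
  xget (fun=> 0) [set J | forall u h, L2 nu u ->
    inner (J u) h = \int[nu]_x inner (u x) (IK h x)].

Definition LK (nu : probability (borel X) R) : H2 -> H2 :=
  IK_adjoint nu \o IK.

Variables (H1 : hilbertType R) (A : H1 -> H2).

(* T_f = A'(f)^* I_K^* I_K A'(f) *)
Definition Top (nu : probability (borel X) R) (f : H1) : H1 -> H1 :=
  adjoint ('d A f) \o LK nu \o 'd A f.

Local Notation Z := (borel X * borel Y)%type.

Definition marginal (rho : probability Z R) : probability (borel X) R :=
  distribution rho (@fst (borel X) (borel Y) : {mfun Z >-> borel X}).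

Definition conditional_distribution (rho : probability Z R)
    (k : R.-pker borel X ~> borel Y) :=
  forall C, measurable C ->
    rho C = (\int[marginal rho]_x k x (xsection C x))%E.

(* The Bochner integral \int y dmu(y), through its pairings with vectors. *)
Definition has_mean (mu : {measure set (borel Y) -> \bar R}) (c : Y) :=
  mu.-integrable setT (fun y : borel Y => `|y : Y|%:E) /\
  forall v : Y, \int[mu]_y inner (y : Y) v = inner c v.

(* The class P_{phi,b}, as the set of pairs (rho, f_rho): no injectivity of A
   is assumed, hence rho alone need not determine f_rho. The conditional
   distribution [k] is unique up to a marginal-null set only, and the condition
   "for all x" is on some version of it. *)
Definition class_P (D : set H1) (fbar : H1) (phi : R -> R)
    (M Sigma Rad beta b : R) : set (probability Z R * H1) :=
  [set q | let rho := q.1 in let f := q.2 in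
    [/\ D° f,
        exists2 k : R.-pker borel X ~> borel Y, conditional_distribution rho k &
          (forall x, has_mean (k x) (ev (A f) x)) /\
          {ae marginal rho, forall x,
            (\int[k x]_y (expR (`|(y : Y) - ev (A f) x| / M)
                          - `|(y : Y) - ev (A f) x| / M - 1)%:E
             <= (Sigma ^+ 2 / (2 * M ^+ 2))%:E)%E},
        exists2 g, f - fbar = opfun phi (Top (marginal rho) f) g & `|g| <= Rad &
        exists2 t, eigenvalues (LK (marginal rho)) t &
          forall n, t n <= beta * n.+1%:R `^ (- b)]].

End rkhs.

Definition Psi (R : realType) (b : R) (phi : R -> R) (t : R) : R :=
  t `^ (2^-1 + (2 * b)^-1) * phi t.

Definition Psi_inv (R : realType) (b : R) (phi : R -> R) : R -> R :=
  'pinv_(fun=> 0) `[0, +oo[ (Psi b phi).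

Definition learning_algorithm (T H : Type) := forall m, m.-tuple T -> H.

(* inf over all algorithms l of sup over (rho, f_rho) in [P] of the probability
   that |f_z^l - f_rho| > r, for samples of size m. Algorithms are arbitrary
   maps, so the event need not be measurable: its probability is taken with the
   outer measure, which is rho^m itself on measurable events. *)
Definition minimax_risk d (T : measurableType d) (R : realType)
    (H : normedModType R) (P : set (probability T R * H)) (m : nat) (r : R) :
    \bar R :=
  ereal_inf [set ereal_sup
      [set mu_ext (iid q.1 m) [set z | r < `|l m z - q.2|] | q in P]
    | l in [set: learning_algorithm T H]].

(* Main.v *)
Require Import Defs.
From HB Require Import structures.
From mathcomp Require Import all_boot all_order all_algebra.
From mathcomp Require Import all_classical all_reals all_analysis.
From mathcomp Require Import measurable_realfun ring lra.

Set Implicit Arguments.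
Unset Strict Implicit.
Unset Printing Implicit Defensive.

Import Order.TTheory GRing.Theory Num.Theory.
Import numFieldNormedType.Exports.

Local Open Scope classical_set_scope.
Local Open Scope ring_scope.

(** The lower bound comes from testing 2^l hypotheses at once.  Fix a small
tau > 0, put s := Psi^-1(m^(-1/2)), r := tau * phi s, and let e_n, t_n be the
eigenvectors and eigenvalues of Tbar := T_fbar.  The candidates are the vertices
f_sg := fbar + \sum_(i < l) +-c e_(l+i) of a hypercube, with signs
sg : {ffun 'I_l -> bool} and c^2 l = 4 r^2.  The dimension l is of order
s^(-1/b), which makes the eigenvalues t_l, ..., t_(2l-1) all of order s and at
least s ([sample_size_scaling]).

Separation.  Two vertices within distance r of the same vector differ in at most
l/4 signs, so whatever the estimate is, it is r-close to at most (9/5)^l of the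
2^l vertices ([vertex_separation], [hamming_ball_card]).

Membership.  The law of f_sg draws x from nu, and then y from the finitely many
points A fbar (x) +- sigma e_j, where e_j is an orthonormal basis of Y; the
probabilities are tilted so that the mean is A f_sg (x) ([noise_mixture]).  The
noise is bounded by 2 sigma, so that a small sigma gives the moment condition for
any M and Sigma ([perturbed_laws]).  For the source condition, first
f_sg - fbar = phi(Tbar) g with |g| <= 2 tau, because t_n >= s.  Both
phi(T_f) = R_f phi(Tbar) and phi(Tbar) are self-adjoint, hence
phi(T_f) = phi(Tbar) R_f^*; as R_f is close to the identity, R_f^* g' = g has a
solution with |g'| <= 2 |g|, and it satisfies phi(T_f) g' = f - fbar
([adjoint_onto], [source_element]).

Indistinguishability.  The law of f has a density with respect to the law P0 of
fbar whose second moment is 1 + C |I_K (A f - A fbar)|^2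
([noise_second_moment]).  With u := f - fbar,
|I_K (A f - A fbar)|^2 <= 2 <Tbar u, u> + 2 gamma^2 |u|^4
([form_perturbation]).  The first term is of order r^2 s because the eigenvalues
are; so is the second one, because the Lipschitz continuity of theta gives
phi(s)^2 <= L^2 s.  Since m phi(s)^2 s = s^(-1/b) is of order l, the second
moment of the density of the m-fold product is at most exp(C' tau^2 l).

Conclusion.  By the Cauchy-Schwarz inequality, a bound c^m on this second moment
gives P_sg(E)^2 <= c^m P0(E) for every event E ([iid_second_moment]).  If each
hypothesis is recognized with probability at least q, summing over sg the events
of success, which overlap at most (9/5)^l times, yields
2^l q^2 <= exp(C' tau^2 l) (9/5)^l ([minimax_risk_ge]).  When tau is below some
tau0 this forces q to 0 as l grows, so that the lower limit over m is exactly 1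
for every tau <= tau0. *)

(** * Geometry of Hilbert spaces *)

Section inner_product.
Context (R : realType) (H : hilbertType R).
Implicit Types (u v w : H) (a c : R).

Lemma innerDr u v w : inner u (v + w) = inner u v + inner u w.
Proof. by rewrite innerC innerDl !(innerC u). Qed.

Lemma innerZr a u v : inner u (a *: v) = a * inner u v.
Proof. by rewrite innerC innerZl innerC. Qed.

Lemma inner0l u : inner 0 u = 0.
Proof. by rewrite -(scale0r (0 : H)) innerZl mul0r. Qed.

Lemma inner0r u : inner u 0 = 0.
Proof. by rewrite innerC inner0l. Qed.

Lemma innerNl u v : inner (- u) v = - inner u v.
Proof. by rewrite -scaleN1r innerZl mulN1r. Qed.

Lemma innerNr u v : inner u (- v) = - inner u v.
Proof. by rewrite innerC innerNl innerC. Qed.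

Lemma innerBl u v w : inner (u - v) w = inner u w - inner v w.
Proof. by rewrite innerDl innerNl. Qed.

Lemma innerBr u v w : inner u (v - w) = inner u v - inner u w.
Proof. by rewrite innerDr innerNr. Qed.

Lemma inner_suml (I : Type) (r : seq I) (P : pred I) (F : I -> H) v :
  inner (\sum_(i <- r | P i) F i) v = \sum_(i <- r | P i) inner (F i) v.
Proof.
by apply: (big_morph (fun u => inner u v)) => [u w|]; rewrite ?innerDl ?inner0l.
Qed.

Lemma inner_sumr (I : Type) (r : seq I) (P : pred I) (F : I -> H) v :
  inner v (\sum_(i <- r | P i) F i) = \sum_(i <- r | P i) inner v (F i).
Proof. by rewrite innerC inner_suml; apply: eq_bigr => i _; rewrite innerC. Qed.

Lemma inner_eq0 u : inner u u = 0 -> u = 0.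
Proof.
by rewrite inner_norm => /eqP; rewrite sqrf_eq0 normr_eq0 => /eqP.
Qed.

Lemma normB_sqr u v : `|u - v| ^+ 2 = `|u| ^+ 2 - 2 * inner u v + `|v| ^+ 2.
Proof.
by rewrite -!inner_norm !innerBl !innerBr (innerC v u); ring.
Qed.

Lemma cauchy_schwarz u v : `|inner u v| <= `|u| * `|v|.
Proof.
have [->|v0] := eqVneq v 0; first by rewrite inner0r !normr0 mulr0.
have nv : 0 < `|v| ^+ 2 by rewrite exprn_gt0// normr_gt0.
rewrite -(ler_pXn2r (_ : 0 < 2)%N) ?nnegrE// ?mulr_ge0// exprMn.
have : 0 <= `|(`|v| ^+ 2) *: u - inner u v *: v| ^+ 2 by rewrite exprn_ge0.
rewrite normB_sqr innerZl innerZr !normrZ !exprMn !real_normK ?num_real//.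
rewrite (_ : _ - _ + _ = `|v| ^+ 2 * (`|u| ^+ 2 * `|v| ^+ 2 - inner u v ^+ 2)).
  by rewrite pmulr_rge0// subr_ge0.
ring.
Qed.

Lemma inner_le u v : inner u v <= `|u| * `|v|.
Proof. exact: le_trans (ler_norm _) (cauchy_schwarz _ _). Qed.

Lemma cvg_innerl v (f : nat -> H) u :
  f n @[n --> \oo] --> u -> inner (f n) v @[n --> \oo] --> inner u v.
Proof.
move=> fu; apply/cvgrPdist_lt => e e0.
have v0 : 0 < `|v| + 1 by rewrite ltr_wpDl.
have /cvgrPdist_lt/(_ (e / (`|v| + 1))) := fu.
rewrite divr_gt0// => /(_ erefl); apply: filterS => x fx.
rewrite -innerBl (le_lt_trans (cauchy_schwarz _ _))//.
rewrite ltr_pdivlMr// in fx; apply: le_lt_trans fx.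
by rewrite ler_wpM2l// lerDl.
Qed.

Arguments cvg_innerl v {f u} _.

Lemma cvg_innerr v (f : nat -> H) u :
  f n @[n --> \oo] --> u -> inner v (f n) @[n --> \oo] --> inner v u.
Proof.
move=> /(cvg_innerl v); rewrite innerC; under eq_fun do rewrite innerC.
exact.
Qed.

Arguments cvg_innerr v {f u} _.

Lemma cauchy_seq_cvg (u : nat -> H) :
  (forall e : R, 0 < e ->
    exists N, forall n m, (N <= n)%N -> (N <= m)%N -> `|u n - u m| < e) ->
  cvgn u.
Proof.
move=> cu; apply/cauchy_cvgP/cauchy_ballP => _/posnumP[e]; near_simpl.
have [N NP] := cu e%:num (ltac:(by [])).
exists ([set n | N <= n], [set n | N <= n])%N; first by split; exists N.
by move=> [n m] [/= Nn Nm]; rewrite -ball_normE /=; apply: NP.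
Qed.

(** Closedness in the form in which it is checked below, by approximations. *)
Definition metrically_closed (W : set H) :=
  forall v, (forall e : R, 0 < e -> exists2 w, W w & `|v - w| < e) -> W v.

(** A sequence that nearly minimizes the distance to [W] is Cauchy by the
parallelogram identity; at its limit the first variation vanishes. *)
Lemma orthogonal_projection (W : set H) v : W 0 ->
  (forall a u w, W u -> W w -> W (a *: u + w)) -> metrically_closed W ->
  exists2 p, W p & forall w, W w -> inner (v - p) w = 0.
Proof.
move=> W0 WD Wcl.
pose S := [set `|v - w| ^+ 2 | w in W].
pose d := inf S.
have S0 : S !=set0 by exists (`|v - 0| ^+ 2), 0.
have Slb : lbound S 0 by move=> _ [w _ <-]; rewrite exprn_ge0.
have hS : has_inf S by split => //; exists 0.
have dle w : W w -> d <= `|v - w| ^+ 2.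
  by move=> Ww; apply: ge_inf; [exists 0|exists w].
have /choice [u uP] n : exists w, W w /\ `|v - w| ^+ 2 < d + n.+1%:R^-1.
  have n0 : (0 : R) < n.+1%:R^-1 by rewrite invr_gt0.
  have [_ [w Ww <-] ltw] := inf_adherent n0 hS.
  by exists w.
(* the parallelogram identity, applied to the midpoint of [x] and [y] *)
have par x y : W x -> W y ->
    `|x - y| ^+ 2 <= 2 * (`|v - x| ^+ 2 - d) + 2 * (`|v - y| ^+ 2 - d).
  move=> Wx Wy.
  have Wm : W (2^-1 *: x + 2^-1 *: y).
    apply: (WD) => //; rewrite -[_ *: y]addr0; exact: WD.
  have := dle _ Wm.
  have -> : `|v - (2^-1 *: x + 2^-1 *: y)| ^+ 2 =
      2^-1 * `|v - x| ^+ 2 + 2^-1 * `|v - y| ^+ 2 - 4^-1 * `|x - y| ^+ 2.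
    by rewrite -!inner_norm !(innerBl, innerBr, innerDl, innerDr, innerZl, innerZr)
       (innerC x v) (innerC y v) (innerC y x); field.
  lra.
have cu : cvgn u.
  apply: cauchy_seq_cvg => e e0.
  have e4 : 0 < e ^+ 2 / 4 by rewrite divr_gt0// exprn_gt0.
  have [N _ NP] := near_infty_natSinv_lt (PosNum e4).
  exists N => n m /NP/= ltn /NP/= ltm.
  rewrite -(ltr_pXn2r (_ : 0 < 2)%N) ?nnegrE//; last exact: ltW.
  have [Wn un] := uP n; have [Wm um] := uP m.
  have := par _ _ Wn Wm; move: un um ltn ltm => /=.
  move: (n.+1%:R^-1) (m.+1%:R^-1) => x y; move: (`|v - u n|) (`|v - u m|) => a1 a2.
  by clear; lra.
have up : u @ \oo --> limn u by [].
exists (limn u).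
  apply: Wcl => e e0; have /cvgrPdist_lt/(_ _ e0) [N _ NP] := up.
  by exists (u N); [case: (uP N)|apply: (NP N) => /=].
have lep : `|v - limn u| ^+ 2 <= d.
  apply/ler_addgt0Pr => e e0.
  have : `|v - u n| ^+ 2 @[n --> \oo] --> `|v - limn u| ^+ 2.
    rewrite expr2; under eq_fun do rewrite expr2.
    by apply: cvgM; apply: cvg_norm; apply: cvgB => //; exact: cvg_cst.
  move=> cvn; rewrite -(cvg_lim (@Rhausdorff R) cvn); apply: limr_le.
    by apply/cvg_ex; eexists; exact: cvn.
  near=> n; have [_ /ltW/le_trans] := uP n; apply; rewrite lerD2l.
  by apply/ltW; near: n; exact: (near_infty_natSinv_lt (PosNum e0)).
move=> w Ww.
have Wp : W (limn u).
  apply: Wcl => e e0; have /cvgrPdist_lt/(_ _ e0) [N _ NP] := up.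
  by exists (u N); [case: (uP N)|apply: (NP N) => /=].
set p := limn u in lep Wp *; set c := inner (v - p) w.
(* nearly the minimizer c / |w|^2 of the quadratic in t, without a case on w = 0 *)
pose t := c / (`|w| ^+ 2 + 1).
have := le_trans lep (dle _ (WD t w p Ww Wp)).
have -> : v - (t *: w + p) = (v - p) - t *: w by rewrite opprD addrCA [RHS]addrC.
rewrite (normB_sqr (v - p)) innerZr -/c normrZ exprMn real_normK ?num_real//.
have w0 : 0 < `|w| ^+ 2 + 1 by rewrite ltr_wpDl// exprn_ge0.
have ct : c = t * (`|w| ^+ 2 + 1) by rewrite /t divfK// gt_eqF.
rewrite ct => le1; apply/eqP; rewrite mulf_eq0; apply/orP; left.
rewrite -sqrf_eq0 eq_le sqr_ge0 andbT.
have := mulr_ge0 (sqr_ge0 t) (exprn_ge0 2 (normr_ge0 w)).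
move: le1; move: (`|v - p| ^+ 2) (`|w| ^+ 2) => x y.
by clear; nra.
Unshelve. all: by end_near. Qed.

Lemma dense_orthogonal (W : set H) : W 0 ->
  (forall a u w, W u -> W w -> W (a *: u + w)) -> metrically_closed W ->
  (forall v, (forall w, W w -> inner v w = 0) -> v = 0) -> forall v, W v.
Proof.
move=> W0 WD Wcl Wperp v; have [p Wp /Wperp/eqP] := orthogonal_projection v W0 WD Wcl.
by rewrite subr_eq0 => /eqP ->.
Qed.

(** The representing vector is a multiple of the component of any vector outside
the kernel that is orthogonal to the kernel. *)
Lemma riesz (F : H -> R) C : (forall a u v, F (a *: u + v) = a * F u + F v) ->
  (forall u, `|F u| <= C * `|u|) -> exists z, forall u, F u = inner u z.
Proof.
move=> Flin Fle.
have F0 : F 0 = 0 by have := Fle 0; rewrite normr0 mulr0 normr_le0 => /eqP.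
have FZ a u : F (a *: u) = a * F u by rewrite -[a *: u]addr0 Flin F0 addr0.
have FD u v : F (u + v) = F u + F v by rewrite -[u]scale1r Flin mul1r scale1r.
have [Fz|/existsNP[v /eqP Fv]] := pselect (forall u, F u = 0).
  by exists 0 => u; rewrite inner0r Fz.
have C0 : 0 < `|C| + 1 by rewrite ltr_wpDl.
pose W := [set u | F u = 0].
have [a u w|u uW|p Wp perp] := @orthogonal_projection W v F0.
- by rewrite /W /= Flin => -> ->; rewrite mulr0 addr0.
- apply/eqP; rewrite /= -normr_le0; apply/ler_addgt0Pr => e e0; rewrite add0r.
  have [|w Ww /ltW uw] := uW (e / (`|C| + 1)); first exact: divr_gt0.
  have -> : F u = F (u - w) by rewrite FD -scaleN1r FZ [F w]Ww mulr0 addr0.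
  apply: le_trans (Fle _) _; apply: le_trans (_ : (`|C| + 1) * `|u - w| <= _).
    rewrite ler_wpM2r//; apply: le_trans (ler_norm C) _; by rewrite lerDl.
  by rewrite mulrC -ler_pdivlMr.
have nE : F (v - p) = F v by rewrite FD -scaleN1r FZ [F p]Wp mulr0 addr0.
set n := v - p in perp nE.
have n0 : inner n n != 0.
  by apply/eqP => /inner_eq0 n0; move: Fv; rewrite -nE n0 F0 eqxx.
exists ((F n / inner n n) *: n) => x; rewrite innerZr.
have Wx : F (x - (F x / F n) *: n) = 0.
  by rewrite FD -scaleNr FZ nE mulNr divfK ?subrr.
have := perp _ Wx; rewrite innerBr innerZr => /eqP; rewrite subr_eq0.
rewrite innerC => /eqP ->; rewrite nE; field.
by rewrite Fv n0.
Qed.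

End inner_product.
Arguments cvg_innerl {R H} v {f u} _.
Arguments cvg_innerr {R H} v {f u} _.

Section orthogonal_expansion.
Context (R : realType) (H : hilbertType R).
Implicit Types (e : nat -> H) (u v w : H).

(** Orthonormal up to zero vectors, like the bases of finite-dimensional spaces,
which are padded with zeros. *)
Definition semi_orthonormal e := (forall i j, i <> j -> inner (e i) (e j) = 0) /\
  forall i, inner (e i) (e i) = 1 \/ e i = 0.

Lemma inner_sum_orth e (a b : nat -> R) m n : semi_orthonormal e ->
  inner (\sum_(m <= k < n) a k *: e k) (\sum_(m <= k < n) b k *: e k) =
  \sum_(m <= k < n) a k * b k * `|e k| ^+ 2.
Proof.
move=> [eo _]; rewrite inner_suml; apply: eq_big_nat => i /andP[mi ilt].
rewrite innerZl inner_sumr (bigD1_seq i) ?mem_index_iota ?mi ?iota_uniq//=.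
rewrite big1 ?addr0; last by move=> j /eqP ji; rewrite innerZr eo ?mulr0//; auto.
by rewrite innerZr inner_norm mulrA.
Qed.

Lemma norm_semi_orthonormal e i : semi_orthonormal e -> `|e i| ^+ 2 = 0 \/ `|e i| ^+ 2 = 1.
Proof.
move=> [_ /(_ i)]; rewrite -inner_norm => -[|] ->; [by right|left].
by rewrite inner0l.
Qed.

Lemma norm_semi_orthonormal_le1 e i : semi_orthonormal e -> `|e i| ^+ 2 <= 1.
Proof. by move=> /norm_semi_orthonormal-/(_ i)[] ->. Qed.

Lemma norm_sum_orth e (a : nat -> R) m n : semi_orthonormal e ->
  `|\sum_(m <= k < n) a k *: e k| ^+ 2 <= \sum_(m <= k < n) a k ^+ 2.
Proof.
move=> oe; rewrite -inner_norm inner_sum_orth//; apply: ler_sum => i _.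
by rewrite -expr2 ler_piMr ?sqr_ge0// norm_semi_orthonormal_le1.
Qed.

Lemma inner_sum_orth_coef e (a : nat -> R) n i : semi_orthonormal e -> (i < n)%N ->
  inner (\sum_(0 <= k < n) a k *: e k) (e i) = a i * `|e i| ^+ 2.
Proof.
move=> [eo _] lt_in; rewrite inner_suml (bigD1_seq i) ?mem_index_iota ?iota_uniq//=.
rewrite big1 ?addr0; last by move=> j /eqP ji; rewrite innerZl eo ?mulr0//; auto.
by rewrite innerZl inner_norm.
Qed.

Lemma bessel e v n : semi_orthonormal e ->
  \sum_(0 <= k < n) inner v (e k) ^+ 2 <= `|v| ^+ 2.
Proof.
move=> oe; have := exprn_ge0 2 (normr_ge0 (v - \sum_(0 <= k < n) inner v (e k) *: e k)).
rewrite normB_sqr -[X in _ + X]inner_norm inner_sum_orth// inner_sumr.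
under [X in 2 * X]eq_bigr do rewrite innerZr -expr2.
set S := (X in 2 * X).
have : \sum_(0 <= k < n) inner v (e k) * inner v (e k) * `|e k| ^+ 2 <= S.
  apply: ler_sum => i _.
  by rewrite -expr2 ler_piMr ?sqr_ge0// norm_semi_orthonormal_le1.
by rewrite -/S; lra.
Qed.

(** The partial sums are Cauchy because the squared norm of a block is dominated
by a block of the convergent Bessel series. *)
Lemma cvg_orth_series e (a : nat -> R) B v : semi_orthonormal e ->
  (forall k, `|a k| <= B) ->
  cvgn (fun n => \sum_(0 <= k < n) (a k * inner v (e k)) *: e k).
Proof.
move=> oe aB; pose S n := \sum_(0 <= k < n) inner v (e k) ^+ 2.
have B0 : 0 <= B by exact: le_trans (aB 0%N).
have cS : cvgn S.
  apply: nondecreasing_is_cvgn.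
    apply/nondecreasing_seqP => n; rewrite /S big_nat_recr//= lerDl; exact: sqr_ge0.
  by exists (`|v| ^+ 2) => _ [n _ <-]; exact: bessel.
apply: cauchy_seq_cvg => eps eps0.
have d0 : 0 < eps ^+ 2 / (B ^+ 2 + 1).
  by rewrite divr_gt0 ?exprn_gt0// ltr_wpDl// sqr_ge0.
have /cauchy_cvgP/cauchy_seriesP/(_ _ d0) := cS.
move=> [[P Q] /= [[N1 _ N1P] [N2 _ N2P]] PQ].
exists (maxn N1 N2).
suff main n m : (maxn N1 N2 <= n)%N -> (maxn N1 N2 <= m)%N -> (n <= m)%N ->
   `|(\sum_(0 <= k < n) (a k * inner v (e k)) *: e k) -
     \sum_(0 <= k < m) (a k * inner v (e k)) *: e k| < eps.
  move=> n m Nn Nm; have [nm|/ltnW nm] := leqP n m; first exact: main.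
  by rewrite distrC; exact: main.
rewrite !geq_max => /andP[N1n N2n] /andP[N1m N2m] nm.
have /= := PQ (n, m) (conj (N1P n N1n) (N2P m N2m)).
rewrite ger0_norm; last by apply: sumr_ge0 => k _; exact: sqr_ge0.
rewrite ltr_pdivlMr ?ltr_wpDl ?sqr_ge0// => small.
rewrite distrC -(ltr_pXn2r (_ : 0 < 2)%N) ?nnegrE//; last exact: ltW.
rewrite (big_cat_nat (leq0n n) nm)/= [X in X - _]addrC addrK.
apply: le_lt_trans (norm_sum_orth _ _ _ oe) _; apply: le_lt_trans small.
rewrite mulrC mulr_sumr; apply: ler_sum => k _.
rewrite exprMn; apply: ler_wpM2r; first exact: sqr_ge0.
rewrite -[X in X <= _]real_normK ?num_real//.
by apply: le_trans (_ : B ^+ 2 <= _); rewrite ?lerDl// lerXn2r ?nnegrE.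
Qed.

Lemma orthonormal_basis_semi e : orthonormal_basis e -> semi_orthonormal e.
Proof.
move=> [eo e1 _]; split=> // i; have [ei|->] := e1 i; last by right.
by left; rewrite inner_norm ei expr1n.
Qed.

(** The series converges by Bessel's inequality, and the difference with its sum
is orthogonal to the whole basis. *)
Lemma basis_expansion e v : orthonormal_basis e ->
  \sum_(0 <= k < n) inner v (e k) *: e k @[n --> \oo] --> v.
Proof.
move=> be; have oe := orthonormal_basis_semi be; have [eo _ ecomp] := be.
have : cvgn (fun n => \sum_(0 <= k < n) (cst 1 k * inner v (e k)) *: e k).
  by apply: (cvg_orth_series (B := 1)) => // k; rewrite normr1.
have -> : (fun n => \sum_(0 <= k < n) (cst 1 k * inner v (e k)) *: e k) =
    fun n => \sum_(0 <= k < n) inner v (e k) *: e k.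
  by apply/funext => n; apply: eq_bigr => k _; rewrite mul1r.
move=> /cvg_ex[w ew]; suff vw : v = w by rewrite [X in _ --> X]vw.
apply/eqP; rewrite -subr_eq0; apply/eqP/ecomp => i.
rewrite innerBl; apply/eqP; rewrite subr_eq0; apply/eqP.
have /cvg_lim <-// := cvg_innerl (e i) ew.
apply: esym; apply: lim_near_cst => //; exists i.+1 => // n /= lt_in.
rewrite inner_sum_orth_coef//.
have [_ /(_ i)] := oe; rewrite -inner_norm => -[|] ->; first by rewrite mulr1.
by rewrite !inner0r mulr0.
Qed.

End orthogonal_expansion.

(** * Spectral calculus *)

Section spectral_calculus.
Context (R : realType) (H : hilbertType R).
Implicit Types (phi : R -> R) (T : H -> H) (t : nat -> R) (e : nat -> H).

(** The partial sums that define phi(T) are symmetric, and so is the default value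
0 taken when T has no eigensystem. *)
Lemma opfun_symmetric phi T u v :
  inner (opfun phi T u) v = inner u (opfun phi T v).
Proof.
rewrite /opfun; case: xgetP => [S _ [t [e [_ SE]]]|_]; last first.
  by rewrite inner0l inner0r.
have := cvg_innerl v (SE u); have := cvg_innerr u (SE v).
have -> : (fun n => inner u (\sum_(0 <= k < n) (phi (t k) * inner v (e k)) *: e k))
        = (fun n => inner (\sum_(0 <= k < n) (phi (t k) * inner u (e k)) *: e k) v).
  apply/funext => n; rewrite inner_suml inner_sumr; apply: eq_bigr => k _.
  by rewrite innerZl innerZr (innerC v); ring.
by move=> + /cvg_lim <-// => /cvg_lim <-.
Qed.

(** The eigenvectors with the irrelevant ones, those of index n with [t n = 0],
replaced by 0, which makes the family orthonormal up to zeros. *)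
Definition masked t e : nat -> H := fun k => if t k == 0 then 0 else e k.

Lemma masked_orthonormal T t e : eigensystem T t e -> semi_orthonormal (masked t e).
Proof.
move=> [_ _ eo _]; split=> [i j /eqP ij|i]; rewrite /masked; last first.
  by case: ifPn => [_|ti]; [right|left; rewrite eo// eqxx].
case: ifPn => [_|ti]; first by rewrite inner0l.
case: ifPn => [_|tj]; first by rewrite inner0r.
by rewrite eo// (negbTE ij).
Qed.

Lemma maskedE phi t e v k : phi 0 = 0 ->
  (phi (t k) * inner v (e k)) *: e k =
  (phi (t k) * inner v (masked t e k)) *: masked t e k.
Proof.
move=> phi0; rewrite /masked; case: eqP => [->|//].
by rewrite phi0 !mul0r !scale0r.
Qed.

Variables (phi : R -> R).
Hypothesis phi0 : phi 0 = 0.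
Hypothesis phi_incr : {in `[0, +oo[ &, {homo phi : s t / s < t}}.

Lemma phi_homo (s r : R) : 0 <= s -> s <= r -> phi s <= phi r.
Proof.
move=> s0; rewrite le_eqVlt => /predU1P[->//|sr]; apply/ltW/phi_incr => //.
  by rewrite in_itv/= s0.
by rewrite in_itv/= (le_trans s0)// ltW.
Qed.

Lemma phi_gt0 (s : R) : 0 < s -> 0 < phi s.
Proof. by move=> s0; rewrite -[ltLHS]phi0 phi_incr// in_itv/= ?lexx// ltW. Qed.

(** Once one eigensystem is known, the defining series converges (Bessel), so that
phi(T) is a genuine value and not the default one.  The eigensystem it is computed
from need not be the given one. *)
Lemma opfun_eigensystem T t e : eigensystem T t e ->
  exists t' e', eigensystem T t' e' /\ forall v,
  \sum_(0 <= k < n) (phi (t' k) * inner v (e' k)) *: e' k @[n --> \oo]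
    --> opfun phi T v.
Proof.
move=> eT; rewrite /opfun; case: xgetP => [S _ //|/(_ _)] none; exfalso.
have [[t_ge0 t_homo] _ _ _] := eT.
have cv v : cvgn (fun n => \sum_(0 <= k < n) (phi (t k) * inner v (e k)) *: e k).
  have -> : (fun n => \sum_(0 <= k < n) (phi (t k) * inner v (e k)) *: e k) =
      fun n => \sum_(0 <= k < n)
        (phi (t k) * inner v (masked t e k)) *: masked t e k.
    by apply/funext => n; apply: eq_bigr => k _; rewrite (maskedE _ _ _ _ phi0).
  apply: (cvg_orth_series (B := phi (t 0%N))); first exact: masked_orthonormal eT.
  move=> k; have le_k : phi (t k) <= phi (t 0%N).
    by apply: phi_homo => //; exact: t_homo.
  by rewrite ger0_norm// -[leLHS]phi0 phi_homo.
apply: (none (fun v => limn (fun n =>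
  \sum_(0 <= k < n) (phi (t k) * inner v (e k)) *: e k))).
by exists t, e; split=> // v; exact: cv.
Qed.

(** Whatever eigensystem phi(T) is computed from: symmetry of T makes [v] orthogonal
to the eigenvectors of another eigenvalue, so phi(T) v is phi(l) times the
projection of [v] onto the span of the eigenvectors, and this projection is [v]
because T vanishes on the orthogonal complement of the span while T v = l v. *)
Lemma opfun_eigen T t e l v : eigensystem T t e ->
  (forall u w, inner (T u) w = inner u (T w)) ->
  0 < l -> T v = l *: v -> opfun phi T v = phi l *: v.
Proof.
move=> /opfun_eigensystem[{}t [{}e [eT Slim]]] Tsym l0 Tv.
have [[t_ge0 t_homo] Te eo Tperp] := eT.
have pl := phi_gt0 l0.
set S := opfun phi T v; pose w := (phi l)^-1 *: S.
have sumE n : \sum_(0 <= k < n) (phi (t k) * inner v (e k)) *: e k =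
    phi l *: \sum_(0 <= k < n) inner v (masked t e k) *: masked t e k.
  rewrite scaler_sumr; apply: eq_bigr => k _.
  rewrite (maskedE _ _ _ _ phi0) scalerA /masked; case: eqP => [|/eqP tk].
    by rewrite !scaler0.
  have [->//|tl] := eqVneq (t k) l.
  suff -> : inner v (e k) = 0 by rewrite !mulr0.
  have : l * inner v (e k) = t k * inner v (e k).
    by rewrite -innerZl -Tv Tsym Te// innerZr.
  move/eqP; rewrite -subr_eq0 -mulrBl mulf_eq0 subr_eq0 eq_sym (negbTE tl)/=.
  by move/eqP.
have wlim : \sum_(0 <= k < n) inner v (masked t e k) *: masked t e k @[n --> \oo] --> w.
  have -> : (fun n => \sum_(0 <= k < n) inner v (masked t e k) *: masked t e k) =
      fun n => (phi l)^-1 *: \sum_(0 <= k < n) (phi (t k) * inner v (e k)) *: e k.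
    by apply/funext => n; rewrite sumE scalerA mulVf ?gt_eqF// scale1r.
  by apply: cvgZl_tmp; exact: Slim.
have om := masked_orthonormal eT.
have perp k : t k != 0 -> inner (v - w) (e k) = 0.
  move=> tk; rewrite innerBl; apply/eqP; rewrite subr_eq0; apply/eqP.
  have <- : masked t e k = e k by rewrite /masked (negbTE tk).
  have /cvg_lim <-// := cvg_innerl (masked t e k) wlim.
  apply: esym; apply: lim_near_cst => //; exists k.+1 => // n /= lt_kn.
  by rewrite inner_sum_orth_coef// -inner_norm /masked (negbTE tk) eo// eqxx mulr1.
have vwv : inner (v - w) v = 0.
  have := Tsym (v - w) v; rewrite Tperp// inner0l Tv innerZr => /esym/eqP.
  by rewrite mulf_eq0 gt_eqF//= => /eqP.
have vww : inner (v - w) w = 0.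
  have /cvg_lim <-// := cvg_innerr (v - w) wlim.
  apply: lim_near_cst => //; exists 0%N => // n _ /=.
  rewrite inner_sumr big1// => k _; rewrite innerZr /masked; case: eqP => [_|/eqP tk].
    by rewrite !inner0r mulr0.
  by rewrite perp// mulr0.
have : v = w.
  by apply/eqP; rewrite -subr_eq0; apply/eqP/inner_eq0; rewrite innerBr vwv vww subrr.
by move=> vw; rewrite [in RHS]vw /w scalerA divff ?gt_eqF// scale1r.
Qed.

End spectral_calculus.

(** * Operators close to the identity *)

Section perturbation.
Context (R : realType) (H : hilbertType R).

(** With Q the adjoint of the contraction I - R_f, provided by Riesz's theorem, the
equation R_f^* g' = g is the fixed-point equation g' = g + Q g'. *)
Lemma adjoint_onto (Rf : {linear H -> H}) (q : R) (g : H) :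
  (forall h, `|Rf h - h| <= q * `|h|) -> 0 <= q -> q <= 2^-1 ->
  exists2 g', `|g'| <= 2 * `|g| & forall w, inner g' (Rf w) = inner g w.
Proof.
move=> near_id q0 q2.
have /choice[Q QE] u : exists z, forall w, inner (w - Rf w) u = inner w z.
  apply: (@riesz _ _ (fun w => inner (w - Rf w) u) (q * `|u|)) => [a v w|w].
    by rewrite linearP/= !(innerBl, innerDl, innerZl); ring.
  apply: le_trans (cauchy_schwarz _ _) _.
  by rewrite mulrAC distrC ler_wpM2r.
have Qcontr u v : `|Q u - Q v| <= q * `|u - v|.
  set z := Q u - Q v.
  have : `|z| ^+ 2 <= q * `|u - v| * `|z|.
    rewrite -inner_norm {2}/z innerBr -!QE -innerBr.
    apply: le_trans (inner_le _ _) _; rewrite mulrAC distrC.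
    by rewrite ler_wpM2r.
  have [->|z0] := eqVneq z 0; first by rewrite normr0 mulr_ge0.
  by rewrite expr2 ler_pM2r// normr_gt0.
pose Phi : H -> H := fun u => g + Q u.
have [|||p _ pE] := @banach_fixed_point R H setT (totalfun Phi).
- exists (NngNum q0); split => /=; first by lra.
  by move=> [u v] _ /=; rewrite /Phi opprD addrACA subrr add0r.
- exact: closedT.
- by exists 0.
have key w : inner p (Rf w) = inner g w.
  have : inner (w - Rf w) p = inner w (p - g).
    by rewrite QE {2}pE /= /Phi addrAC subrr add0r.
  by rewrite innerBl innerBr (innerC (Rf w)) (innerC w g) => /eqP; rewrite
     subr_eq addrC -subr_eq opprB addrA => /eqP; lra.
exists p => //.
have : `|p| ^+ 2 <= `|g| * `|p| + q * `|p| * `|p|.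
  rewrite -inner_norm -[X in inner p X](subrK (Rf p)) innerDr key addrC lerD//.
    exact: inner_le.
  apply: le_trans (inner_le _ _) _; rewrite mulrC distrC; exact: ler_wpM2r.
have [->|p0] := eqVneq p 0; first by rewrite normr0 mulr_ge0.
have {p0}: 0 < `|p| by rewrite normr_gt0.
move: `|p| `|g| => x y x0; rewrite expr2 -mulrDl ler_pM2r// => xle.
have : q * x <= 2^-1 * x by rewrite ler_wpM2r// ltW.
by lra.
Qed.

End perturbation.

(** * Finite-dimensional output spaces *)

Section finite_dimension.
Context (R : realType) (Y : hilbertType R).

(** Otherwise [n.+1] nonzero vectors of the family could be selected; expressed on
the [n] spanning vectors they satisfy a linear relation, which orthonormality
forbids. *)
Lemma orthonormal_finite (e : nat -> Y) : finite_dimensional Y ->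
  semi_orthonormal e -> exists N, forall j, (N <= j)%N -> e j = 0.
Proof.
move=> [n [f fspan]] [eo e1].
apply: contrapT => /forallNP none.
have next N : exists2 j, (N <= j)%N & e j <> 0.
  by have /existsNP[j /not_implyP[Nj ej]] := none N; exists j.
have /choice[nx nxP] N : exists j, (N <= j)%N /\ e j <> 0.
  by have [j] := next N; exists j.
pose fix js k := if k is k'.+1 then nx (js k').+1 else nx 0%N.
have js_incr k : (js k < js k.+1)%N by have [] := nxP (js k).+1.
have js_mono : {homo js : i j / (i < j)%N}.
  by apply: homo_ltn => //; exact: ltn_trans.
have js_inj i j : i <> j -> js i <> js j.
  move=> /eqP; rewrite neq_ltn => /orP[/js_mono|/js_mono] + jE; by rewrite jE ltnn.
have js0 k : e (js k) <> 0 by case: k => [|k]; apply: (nxP _).2.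
have /choice[c cE] v : exists c : 'I_n -> R, v = \sum_i c i *: f i by exact: fspan.
pose C : 'M[R]_(n.+1, n) := \matrix_(i, k) c (e (js i)) k.
have [a /andP[a0 /eqP aC]] : exists a : 'rV[R]_n.+1, (a != 0) && (a *m C == 0).
  have : kermx C != 0.
    rewrite -mxrank_eq0 mxrank_ker subn_eq0 -ltnNge.
    by rewrite ltnS (leq_trans (rank_leq_col _)).
  move=> /rowV0Pn[a /sub_kermxP aC a0]; by exists a; rewrite a0 aC eqxx.
have sum0 : \sum_i a 0 i *: e (js i) = 0.
  under eq_bigr do rewrite (cE (e (js _))) scaler_sumr.
  rewrite exchange_big/= big1// => k _.
  under eq_bigr do rewrite scalerA.
  have /matrixP/(_ 0 k) := aC; rewrite !mxE => sE.
  rewrite -scaler_suml [X in X *: _](_ : _ = 0) ?scale0r// -[RHS]sE.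
  by apply: eq_bigr => j _; rewrite mxE.
move: a0 => /eqP; apply; apply/rowP => i; rewrite [RHS]mxE.
have := congr1 (fun v => inner v (e (js i))) sum0.
rewrite inner0l inner_suml (bigD1 i)//= big1 ?addr0.
  rewrite innerZl; have [->|/(js0 i)//] := e1 (js i); by rewrite mulr1.
move=> j /eqP ji; rewrite innerZl eo ?mulr0//; apply: js_inj => ij.
by apply: ji; exact: val_inj.
Qed.

Lemma finite_expansion (e : nat -> Y) N v : orthonormal_basis e ->
  (forall j, (N <= j)%N -> e j = 0) -> v = \sum_(j < N) inner v (e j) *: e j.
Proof.
move=> be eN; have := basis_expansion (v := v) be => /(cvg_lim (@norm_hausdorff _ _)) {1}<-.
apply: lim_near_cst; first exact: norm_hausdorff.
exists N => // n /= Nn; rewrite -(big_mkord xpredT (fun j => inner v (e j) *: e j)).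
rewrite (big_cat_nat (leq0n N) Nn)/= [X in _ + X]big_nat [X in _ + X]big1 ?addr0//.
by move=> j /andP[/eN -> _]; rewrite scaler0.
Qed.

Lemma finite_parseval (e : nat -> Y) N u v : orthonormal_basis e ->
  (forall j, (N <= j)%N -> e j = 0) ->
  inner u v = \sum_(j < N) inner u (e j) * inner v (e j).
Proof.
move=> be eN; rewrite [in LHS](finite_expansion u be eN) inner_suml.
by apply: eq_bigr => j _; rewrite innerZl (innerC v).
Qed.

End finite_dimension.

(** * Measurability of the functions of the kernel space *)

Section borel_measurability.
Context (R : realType).

Lemma continuous_borel (V : normedModType R) (f : V -> R) :
  continuous f -> measurable_fun setT (f : borel V -> R).
Proof.
move=> /continuousP cf; apply: (measurability _ (RGenOpens.measurableE R)).
move=> _ [_ [a [b ->] <-]]; rewrite setTI; apply: sub_sigma_algebra.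
exact/cf/interval_open.
Qed.

Context d (T : measurableType d) (Y : hilbertType R).

Lemma measurable_inner_coord (e : nat -> Y) N (u w : T -> Y) :
  orthonormal_basis e -> (forall j, (N <= j)%N -> e j = 0) ->
  (forall j, measurable_fun setT (fun x => inner (u x) (e j))) ->
  (forall j, measurable_fun setT (fun x => inner (w x) (e j))) ->
  measurable_fun setT (fun x => inner (u x) (w x)).
Proof.
move=> be eN mu mw; under eq_fun do rewrite (finite_parseval _ _ be eN).
by apply: measurable_sum => j; exact: measurable_funM.
Qed.

(** An open set is a countable union of balls with centres in a dense sequence, and
the squared distance to a centre is a finite sum of squares of coordinates. *)
Lemma measurable_coord (e : nat -> Y) N (u : T -> Y) : separable Y ->
  orthonormal_basis e -> (forall j, (N <= j)%N -> e j = 0) ->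
  (forall j, measurable_fun setT (fun x => inner (u x) (e j))) ->
  measurable_fun setT (u : T -> borel Y).
Proof.
move=> [D cD dD] be eN mu.
have mball q (r : R) : measurable [set x | `|u x - q| < r].
  have [r0|r0] := ltP 0 r; last first.
    rewrite (_ : [set _ | _] = set0)// -subset0 => x /= /lt_le_trans/(_ r0).
    by rewrite ltNge normr_ge0.
  rewrite (_ : [set _ | _] = setT `&` [set x | inner (u x - q) (u x - q) < r ^+ 2]).
    have mq j : measurable_fun setT (fun x => inner (u x - q) (e j)).
      by under eq_fun do rewrite innerBl; exact: measurable_funB.
    have := measurable_fun_ltr (measurable_inner_coord be eN mq mq)
      (measurable_cst (r ^+ 2)).
    move=> /(_ measurableT [set true] I).
    by rewrite !setTI; congr measurable; apply/seteqP; split.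
  rewrite setTI; apply/seteqP; split => x /=; rewrite inner_norm;
    by rewrite ltr_pXn2r ?nnegrE// ltW.
have /countable_injP[f finj] := cD.
apply: (@measurability _ _ T (borel Y) setT u (@open Y) erefl) => _ [U oU <-]; rewrite setTI.
(* the centre is referred to by its number [n] in the enumeration [f] *)
pose F (n k : nat) := [set x | exists q, [/\ D q, f q = n,
   ball q k.+1%:R^-1 `<=` U & `|u x - q| < k.+1%:R^-1]].
have -> : u @^-1` U = \bigcup_n \bigcup_k F n k.
  apply/seteqP; split => [x /= Ux|x [n _ [k _ [q [Dq _ + uq]]]]]; last first.
    by apply; rewrite -ball_normE /= distrC.
  have /nbhs_ballP[r /= r0 rU] : nbhs (u x) U by exact: open_nbhs_nbhs.
  have r2 : 0 < r / 2 by rewrite divr_gt0.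
  have [k _ /(_ k (leqnn k)) /= kr] := near_infty_natSinv_lt (PosNum r2).
  have [|q [uxq Dq]] := dD (ball (u x) k.+1%:R^-1) _ (ball_open (u x) _).
    by exists (u x); apply: ballxx; rewrite invr_gt0.
  move: uxq; rewrite -ball_normE /= => uxq.
  exists (f q) => //; exists k => //; exists q; split => // y.
  rewrite -ball_normE /= => qy; apply: rU; rewrite -ball_normE /=.
  rewrite -(subrK q (u x)) -addrA (le_lt_trans (ler_normD _ _))//.
  by rewrite (lt_trans (ltrD uxq qy))// [ltRHS]splitr ltrD.
apply: bigcupT_measurable => n; apply: bigcupT_measurable => k.
have [[q [Dq fq qU]]|none] :=
  pselect (exists q, [/\ D q, f q = n & ball q k.+1%:R^-1 `<=` U]).
  rewrite (_ : F n k = [set x | `|u x - q| < k.+1%:R^-1])//.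
  apply/seteqP; split => [x [q' [Dq' fq' _]]|x /= xq]; last by exists q.
  have -> // : q' = q by apply: finj; rewrite ?inE// fq fq'.
rewrite (_ : F n k = set0)// -subset0 => x [q [Dq fq qU _]].
by apply: none; exists q.
Qed.

End borel_measurability.

Section rkhs_facts.
Context (R : realType) (X : completePseudoMetricType R) (Y H2 : hilbertType R).
Context (ev : H2 -> X -> Y) (K : X -> X -> Y -> Y) (K_ : X -> Y -> H2).
Hypothesis kerK : kernel_assumption ev K K_.
Implicit Types (h : H2) (x : X) (nu : probability (borel X) R).

Lemma evP a h h' x : ev (a *: h + h') x = a *: ev h x + ev h' x.
Proof. exact: (ev_linear kerK). Qed.

Lemma ev0 x : ev 0 x = 0.
Proof. by have := evP (-1) 0 0 x; rewrite !scaleN1r oppr0 addr0 addNr. Qed.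

Lemma evB h h' x : ev (h - h') x = ev h x - ev h' x.
Proof. by rewrite addrC -scaleN1r evP scaleN1r addrC. Qed.

(** The [h] with this property form a closed subspace that contains all [K_ x v],
by measurability of the kernel; a vector orthogonal to all [K_ x v] is zero by the
reproducing property. *)
Lemma measurable_inner_ev h w :
  measurable_fun setT (fun x : borel X => inner (ev h x) w).
Proof.
move: w; pose W := [set h | forall w,
  measurable_fun setT (fun x : borel X => inner (ev h x) w)].
apply: (@dense_orthogonal _ _ W) h => [w|a u v Wu Wv w|v vW w|v vperp].
- by under eq_fun do rewrite ev0 inner0l; exact: measurable_cst.
- under eq_fun do rewrite evP innerDl innerZl.
  apply: measurable_funD; last exact: Wv.
  by apply: measurable_funM; [exact: measurable_cst|exact: Wu].
- have /choice[u uP] n : exists u, W u /\ `|v - u| < n.+1%:R^-1.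
    by have [|u Wu uv] := vW n.+1%:R^-1; [rewrite invr_gt0|exists u].
  have uv : u @ \oo --> v.
    apply/cvgrPdist_lt => e e0.
    have [N _ NP] := near_infty_natSinv_lt (PosNum e0).
    by exists N => // n /NP /= ltn; apply: lt_trans ltn; case: (uP n).
  apply: (@measurable_fun_cvg _ _ _ _ (fun n (x : borel X) => inner (ev (u n) x) w)).
    by move=> n; case: (uP n).
  move=> x _; rewrite (kernel_reproducing kerK).
  under eq_fun do rewrite (kernel_reproducing kerK).
  exact: cvg_innerl.
- apply: (ev_injective kerK); apply/funext => t; rewrite ev0.
  apply: inner_eq0; rewrite (kernel_reproducing kerK); apply: vperp => w.
  under eq_fun do rewrite (kernel_reproducing kerK).
  have mf := kernel_measurable kerK (ev v t) w.
  have mg : measurable_fun setT (fun x : borel X => (x, t : borel X)).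
    exact: pair2_measurable.
  exact: measurableT_comp mf mg.
Qed.

(** The bound is sqrt(C) with C the supremum of tr(K_x^* K_x), since the coordinates
of [ev h x] are the <h, K_x e_j>; the same basis serves to see that only finitely
many e_j are nonzero. *)
Lemma ev_bounded : finite_dimensional Y -> exists (e : nat -> Y) N kappa,
  [/\ orthonormal_basis e, forall j, (N <= j)%N -> e j = 0, 0 <= kappa &
      forall h x, `|ev h x| <= kappa * `|h|].
Proof.
move=> dimY; have [e be esup] := kernel_trace kerK.
have [N eN] := orthonormal_finite dimY (orthonormal_basis_semi be).
pose s x := (\sum_(j < N) `|K_ x (e j)| ^+ 2)%R.
have s_ge0 x : 0 <= s x by apply: sumr_ge0 => j _; exact: exprn_ge0.
move: esup; set S := ereal_sup _ => esup.
have sS x : ((s x)%:E <= S)%E.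
  apply: le_trans (ereal_sup_ubound _); last by exists x.
  rewrite /s -(big_mkord xpredT (fun j => `|K_ x (e j)| ^+ 2)) -sumEFin.
  by apply: nneseries_lim_ge => k _; rewrite lee_fin exprn_ge0.
have [C C0 sC] : exists2 C : R, 0 <= C & forall x, s x <= C.
  move: S sS esup => [r|//|] sS _; last first.
    by exists 0 => // x; have := sS x; rewrite leeNy_eq.
  exists (Num.max 0 r) => [|x]; first by rewrite le_max lexx.
  by rewrite le_max -(lee_fin _ r) sS orbT.
exists e, N, (Num.sqrt C); split => // h x.
rewrite -(ler_pXn2r (_ : 0 < 2)%N) ?nnegrE// ?mulr_ge0 ?sqrtr_ge0//.
rewrite exprMn sqr_sqrtr// -inner_norm (finite_parseval _ _ be eN).
apply: le_trans (_ : \sum_(j < N) `|K_ x (e j)| ^+ 2 * `|h| ^+ 2 <= _).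
  apply: ler_sum => j _; rewrite -expr2 (kernel_reproducing kerK) -exprMn mulrC.
  rewrite -[leLHS]real_normK ?num_real//.
  by rewrite lerXn2r ?nnegrE ?mulr_ge0// cauchy_schwarz.
by rewrite -mulr_suml ler_wpM2r ?exprn_ge0//; exact: sC.
Qed.

Lemma measurable_ev h : separable Y -> finite_dimensional Y ->
  measurable_fun setT (ev h : borel X -> borel Y).
Proof.
move=> sepY dimY; have [e [N [_ [be eN _ _]]]] := ev_bounded dimY.
by apply: measurable_coord be eN _ => // j; exact: measurable_inner_ev.
Qed.

Hypothesis sepY : separable Y.
Hypothesis dimY : finite_dimensional Y.

Lemma measurable_inner_ev2 h h' :
  measurable_fun setT (fun x : borel X => inner (ev h x) (ev h' x)).
Proof.
have [e [N [_ [be eN _ _]]]] := ev_bounded dimY.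
by apply: measurable_inner_coord be eN _ _ => j; exact: measurable_inner_ev.
Qed.

Lemma bounded_integrable d (T : measurableType d) (mu : probability T R)
  (f : T -> R) (B : R) : measurable_fun setT f -> (forall z, `|f z| <= B) ->
  mu.-integrable setT (EFin \o f).
Proof.
move=> mf fB; apply: (@le_integrable _ _ _ _ _ _ _ (EFin \o cst B)) => //.
- exact/measurable_EFinP.
- by move=> x _ /=; rewrite lee_fin (le_trans (fB x))// ler_norm.
- exact: finite_measure_integrable_cst.
Qed.

Lemma integrable_ev2 nu h h' :
  nu.-integrable setT (EFin \o (fun x : borel X => inner (ev h x) (ev h' x))).
Proof.
have [e [N [k [be eN k0 evk]]]] := ev_bounded dimY.
apply: (@bounded_integrable _ _ _ _ ((k * `|h|) * (k * `|h'|))).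
  exact: measurable_inner_ev2.
by move=> x; rewrite (le_trans (cauchy_schwarz _ _))// ler_pM.
Qed.

Lemma L2_ev nu h : L2 nu (ev h) /\ L2_sqnorm nu (ev h) =
  (\int[nu]_x inner (ev h x) (ev h x))%:E.
Proof.
have E : L2_sqnorm nu (ev h) = (\int[nu]_x inner (ev h x) (ev h x))%:E.
  rewrite /L2_sqnorm /Rintegral fineK.
    by apply: eq_integral => x _; rewrite inner_norm.
  by apply: integrable_fin_num => //; exact: integrable_ev2.
by split=> //; split; [exact: measurable_ev|rewrite E ltry].
Qed.

(** The definition of [IK_adjoint] falls back on the map 0 if the adjoint does not
exist, so a nonzero value of [LK] certifies that it is the adjoint. *)
Lemma IK_adjointP nu : (exists h, LK ev nu h <> 0) ->
  forall h h', inner (LK ev nu h) h' = \int[nu]_x inner (ev h x) (ev h' x).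
Proof.
rewrite /LK /IK_adjoint /IK /=; case: xgetP => [J _ JP _ h h'|_ [h]//].
by rewrite JP//; exact: (L2_ev nu h).1.
Qed.

End rkhs_facts.

(** * Taylor expansion in the seminorm of L2 *)

Section line_derivative.
Context (R : realType) (H1 H2 : hilbertType R).

(** The copy of [inner] with values in the normed module [R^o], as differential
calculus requires. *)
Definition innerl (z : H2) : H2 -> R^o := inner z.

Lemma innerl_is_linear z : linear (innerl z).
Proof. by move=> a u v; rewrite /innerl innerDr innerZr. Qed.

HB.instance Definition _ z := GRing.isLinear.Build R H2 R^o _ (innerl z)
  (innerl_is_linear z).

Lemma continuous_innerl z : continuous (innerl z).
Proof.
apply: bounded_linear_continuous; apply/linear_boundedP.
near=> r => v; apply: le_trans (cauchy_schwarz _ _) _.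
by rewrite ler_wpM2r//; near: r; apply: nbhs_pinfty_ge; rewrite num_real.
Unshelve. all: by end_near. Qed.

Lemma is_derive_inner_line (A : H1 -> H2) z f u (s : R) :
  differentiable A (f + s *: u) ->
  is_derive s (1 : R) (fun s => inner z (A (f + s *: u)))
    (inner z ('d A (f + s *: u) u)).
Proof.
move=> dA.
pose line (s : R) := f + s *: u.
have dsc : is_diff s ( *:%R^~ u : R -> H1) ( *:%R^~ u) by exact: is_diff_scalel.
have lineE : line = (cst f : R -> H1) + *:%R^~ u by apply/funext.
have dcst : is_diff s (cst f : R -> H1) 0 by exact: is_diff_cst.
have dl := is_diffD dcst dsc; rewrite -lineE add0r in dl.
have dAd : is_diff (line s) A ('d A (line s)) by exact: (DiffDef _ dA erefl).
have di w : is_diff w (innerl z) (innerl z).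
  apply: DiffDef; first exact/linear_differentiable/continuous_innerl.
  by rewrite diff_lin//; exact: continuous_innerl.
have dG := is_diff_comp (is_diff_comp dl dAd) (di _).
have [exG valG] := dG.
apply: (@DeriveDef _ _ _ _ _ (innerl z \o (A \o line))).
  exact: diff_derivable.
by rewrite deriveE// valG /= scale1r.
Qed.

End line_derivative.

(** In this section <B h, h> stands for the squared norm of [IK h] in L2, with
[B := LK ev nu]. *)
Section taylor.
Context (R : realType) (H1 H2 : hilbertType R) (A : H1 -> H2) (B : H2 -> H2).
Hypothesis BC : forall h h', inner (B h) h' = inner (B h') h.
Hypothesis B_ge0 : forall h, 0 <= inner (B h) h.

Lemma form_expand a h h' : inner (B (h + a *: h')) (h + a *: h') =
  inner (B h) h + 2 * a * inner (B h) h' + a ^+ 2 * inner (B h') h'.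
Proof.
rewrite innerDr innerZr 2!(BC (h + _)) !innerDr !innerZr (BC h' h); ring.
Qed.

Lemma form_le h h' : 2 * inner (B h) h' <= inner (B h) h + inner (B h') h'.
Proof.
have := B_ge0 (h + (-1) *: h'); rewrite form_expand; lra.
Qed.

Lemma formD_le h h' :
  inner (B (h + h')) (h + h') <= 2 * inner (B h) h + 2 * inner (B h') h'.
Proof.
have := form_le h h'; have := form_expand 1 h h'; rewrite !scale1r => ->; lra.
Qed.

Lemma formZ a h : inner (B (a *: h)) (a *: h) = a ^+ 2 * inner (B h) h.
Proof. by rewrite innerZr BC innerZr; ring. Qed.

(** The Cauchy-Schwarz inequality, obtained without square roots by applying
[form_le] to [c j *: h k] and [c k *: h j] for every pair of indices. *)
Lemma form_sum_le n (c : nat -> R) (h : nat -> H2) :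
  inner (B (\sum_(0 <= k < n) c k *: h k)) (\sum_(0 <= k < n) c k *: h k) <=
  (\sum_(0 <= k < n) c k ^+ 2) * \sum_(0 <= k < n) inner (B (h k)) (h k).
Proof.
rewrite inner_sumr.
have -> : forall S, \sum_(0 <= k < n) inner (B S) (c k *: h k) =
    \sum_(0 <= k < n) c k * inner (B (h k)) S.
  by move=> S; apply: eq_bigr => k _; rewrite innerZr BC.
under eq_bigr => k _ do rewrite inner_sumr mulr_sumr.
have -> : (\sum_(0 <= k < n) c k ^+ 2) * \sum_(0 <= k < n) inner (B (h k)) (h k) =
   2^-1 * (\sum_(0 <= k < n) \sum_(0 <= j < n)
      (c k ^+ 2 * inner (B (h j)) (h j) + c j ^+ 2 * inner (B (h k)) (h k))).
  have -> : (\sum_(0 <= k < n) c k ^+ 2) * \sum_(0 <= k < n) inner (B (h k)) (h k) =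
      \sum_(0 <= k < n) \sum_(0 <= j < n) c k ^+ 2 * inner (B (h j)) (h j).
    by rewrite mulr_suml; apply: eq_bigr => k _; rewrite mulr_sumr.
  transitivity (2^-1 * (\sum_(0 <= k < n)
       (\sum_(0 <= j < n) c k ^+ 2 * inner (B (h j)) (h j) +
        \sum_(0 <= j < n) c j ^+ 2 * inner (B (h k)) (h k)))); last first.
    by congr (_ * _); apply: eq_bigr => k _; rewrite -big_split.
  rewrite big_split/= [X in _ + X]exchange_big/=.
  by rewrite -mulr2n -[X in _ * X]mulr_natl mulrA mulVf ?pnatr_eq0// mul1r.
rewrite mulr_sumr; apply: ler_sum => k _; rewrite mulr_sumr.
apply: ler_sum => j _.
have := form_le (c j *: h k) (c k *: h j); rewrite !formZ innerZr BC innerZr BC.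
rewrite innerZr; lra.
Qed.

(** The operator norm is at most the Hilbert-Schmidt norm. *)
Lemma hilbert_schmidt_form_le (Q : H1 -> H2) (e : nat -> H1) (c2 : R) u :
  (forall a u v, Q (a *: u + v) = a *: Q u + Q v) -> continuous Q ->
  orthonormal_basis e ->
  (forall n, \sum_(0 <= k < n) inner (B (Q (e k))) (Q (e k)) <= c2) ->
  inner (B (Q u)) (Q u) <= c2 * `|u| ^+ 2.
Proof.
move=> Qlin cQ be hs.
have Q0 : Q 0 = 0 by have := Qlin (-1) 0 0; rewrite !scaleN1r oppr0 addr0 addNr.
pose un n := \sum_(0 <= k < n) inner u (e k) *: e k.
have QE n : Q (un n) = \sum_(0 <= k < n) inner u (e k) *: Q (e k).
  rewrite /un; elim/big_rec2: _ => [//|k _ v _ <-]; exact: Qlin.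
have le_n n : inner (B (Q (un n))) (Q (un n)) <= c2 * `|u| ^+ 2.
  rewrite QE; apply: le_trans (form_sum_le _ _ _) _; rewrite mulrC.
  apply: ler_pM => //; first by apply: sumr_ge0 => k _; exact: B_ge0.
    by apply: sumr_ge0 => k _; exact: sqr_ge0.
  exact: bessel (orthonormal_basis_semi be).
have Qun : Q (un n) @[n --> \oo] --> Q u.
  apply: continuous_cvg; [exact: cQ|exact: basis_expansion].
have := cvg_innerr (B (Q u)) Qun => lim.
(* pass to the limit in the second argument of <B (Q u), .>, which is continuous *)
have : 2 * inner (B (Q u)) (Q u) <= inner (B (Q u)) (Q u) + c2 * `|u| ^+ 2.
  have : 2 * inner (B (Q u)) (Q (un n)) @[n --> \oo] --> 2 * inner (B (Q u)) (Q u).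
    by apply: cvgM; [exact: cvg_cst|].
  move=> /[dup] c /cvg_lim <- //; apply: limr_le; first by apply/cvg_ex; eexists; exact: c.
  by apply: nearW => n; apply: le_trans (form_le _ _) _; rewrite lerD2l.
lra.
Qed.

(** With w the remainder, the mean value theorem applied to
s |-> <B w, A (f + s u)> - s <B w, A'(f) u> gives <B w, w> = <B w, d> for the
increment d of the derivative at some s, and 2 <B w, d> <= <B w, w> + <B d, d>. *)
Lemma taylor_form f u c2 :
  (forall s : R, 0 <= s <= 1 -> differentiable A (f + s *: u)) ->
  (forall s : R, 0 <= s <= 1 ->
     inner (B ('d A (f + s *: u) u - 'd A f u)) ('d A (f + s *: u) u - 'd A f u)
       <= c2) ->
  inner (B (A (f + u) - A f - 'd A f u)) (A (f + u) - A f - 'd A f u) <= c2.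
Proof.
move=> dA le_c2; set w := A (f + u) - A f - 'd A f u.
pose c := inner (B w) ('d A f u).
pose G (s : R) := inner (B w) (A (f + s *: u)) - s * c.
pose G' (s : R) := inner (B w) ('d A (f + s *: u) u) - c.
have dG (s : R) : 0 <= s <= 1 -> is_derive s (1 : R) G (G' s).
  move=> /dA dAs; have d1 := is_derive_inner_line (B w) dAs.
  have d2 : is_derive s (1 : R) (fun s : R => s * c) c.
    by apply: is_derive_eq; rewrite scaler0 add0r /GRing.scale /= mulr1.
  exact: is_deriveB d1 d2.
have [//|s s01||s s01] := @MVT R G G' 0 1.
- by apply: dG; move: s01; rewrite in_itv/= => /andP[/ltW-> /ltW->].
- by apply: derivable_within_continuous => s; rewrite in_itv/= => /dG[].
have s01' : 0 <= s <= 1 by move: s01; rewrite in_itv/= => /andP[/ltW-> /ltW->].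
rewrite subr0 mulr1 /G scale1r scale0r addr0 mul0r subr0 mul1r /G' /c => Geq.
have : inner (B w) w = inner (B w) ('d A (f + s *: u) u - 'd A f u).
  rewrite [RHS]innerBr -Geq.
  transitivity (inner (B w) (A (f + u) - A f - 'd A f u)) => //.
  by rewrite !innerBr; ring.
have := form_le w ('d A (f + s *: u) u - 'd A f u); have := le_c2 s s01'.
lra.
Qed.

End taylor.

(** * Regression laws with finitely supported noise *)

Section finite_mixture.
Context d d' (T : measurableType d) (S : measurableType d') (R : realType).

(** The conditional law given [x] puts the mass [weight i x] on [atom i x], i < n. *)
Record mixture (n : nat) := Mixture {
  atom : nat -> T -> S ;
  weight : nat -> T -> R ;
  measurable_atom : forall i, measurable_fun setT (atom i) ;
  measurable_weight : forall i, measurable_fun setT (weight i) ;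
  weight_ge0 : forall i x, 0 <= weight i x ;
  weight_sum : forall x, \sum_(i < n) weight i x = 1 }.

Definition mix_ker n (M : mixture n) (x : T) : {measure set S -> \bar R} :=
  msum (fun i => mscale (NngNum (weight_ge0 M i x)) (dirac (atom M i x))) n.

Lemma mix_kerE n (M : mixture n) x (U : set S) :
  mix_ker M x U = (\sum_(i < n) weight M i x * \1_U (atom M i x))%:E.
Proof. by rewrite -sumEFin; apply: eq_bigr => i _; rewrite /mscale/= EFinM. Qed.

Section kernel.
Context n (M : mixture n).

Let measurable_mix U : measurable U -> measurable_fun setT (mix_ker M ^~ U).
Proof.
move=> mU; rewrite (_ : mix_ker M ^~ U =
    EFin \o (fun x => \sum_(i < n) weight M i x * \1_U (atom M i x))); last first.
  by apply/funext => x; rewrite mix_kerE.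
apply/measurable_EFinP; apply: measurable_sum => i.
apply: measurable_funM; first exact: measurable_weight.
apply: (@measurableT_comp _ _ _ _ _ _ (\1_U : S -> R)).
  exact: measurable_indic.
exact: measurable_atom.
Qed.

HB.instance Definition _ := isKernel.Build _ _ _ _ _ (mix_ker M) measurable_mix.

Let mix1 x : mix_ker M x setT = 1%E.
Proof.
rewrite mix_kerE; under eq_bigr do rewrite indicT mulr1.
by rewrite weight_sum.
Qed.

HB.instance Definition _ :=
  Kernel_isProbability.Build _ _ _ _ _ (mix_ker M) mix1.

Lemma ge0_integral_mix x (f : S -> \bar R) :
  (forall y, 0 <= f y)%E -> measurable_fun setT f ->
  (\int[mix_ker M x]_y f y =
   \sum_(i < n) (weight M i x)%:E * f (atom M i x))%E.
Proof.
move=> f0 mf; rewrite ge0_integral_measure_sum//.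
apply: eq_bigr => i _; rewrite ge0_integral_mscale//.
by rewrite integral_dirac// diracT mul1e.
Qed.

Lemma integral_mix x (f : S -> R) : measurable_fun setT f ->
  (\int[mix_ker M x]_y (f y)%:E = (\sum_(i < n) weight M i x * f (atom M i x))%:E)%E.
Proof.
move=> mf; rewrite integralE !ge0_integral_mix//; last 2 first.
- by apply: measurable_funeneg; exact/measurable_EFinP.
- by apply: measurable_funepos; exact/measurable_EFinP.
rewrite (eq_bigr (fun i : 'I_n => (weight M i x * Num.max (f (atom M i x)) 0)%:E)); last first.
  by move=> i _; rewrite funeposE -EFin_max EFinM.
rewrite [X in (_ - X)%E](eq_bigr (fun i : 'I_n =>
    (weight M i x * Num.max (- f (atom M i x)) 0)%:E)); last first.
  by move=> i _; rewrite funenegE -EFinN -EFin_max EFinM.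
rewrite !sumEFin -EFinB -sumrB; congr _%:E; apply: eq_bigr => i _.
rewrite -mulrBr; congr (_ * _).
by have [] := leP (f (atom M i x)) 0; have [] := leP (- f (atom M i x)) 0; lra.
Qed.

End kernel.
End finite_mixture.

Section joint.
Context d d' (X : measurableType d) (Y : measurableType d') (R : realType).
Context n (M : mixture X Y R n) (nu : probability X R).

(** The law of the pair (x, y) given x, with a parameter in [unit]: the joint law
is then a composition of kernels, whose integrals are iterated integrals. *)
Program Definition graph_mixture : mixture (unit * X)%type (X * Y)%type R n := {|
  atom := fun i p => (p.2, atom M i p.2) ;
  weight := fun i p => weight M i p.2 |}.
Next Obligation.
move=> i; apply: measurable_fun_pair => //.
by apply: measurableT_comp; first exact: measurable_atom.
Qed.
Next Obligation.
by move=> i; apply: measurableT_comp; first exact: measurable_weight.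
Qed.
Next Obligation. by move=> i x; exact: weight_ge0. Qed.
Next Obligation. by move=> x; exact: weight_sum. Qed.

Let base : unit -> pprobability X R := fun=> nu.
Let mbase : measurable_fun setT base. Proof. exact: measurable_cst. Qed.

Definition joint : set (X * Y) -> \bar R :=
  kcomp (kprobability mbase) (mix_ker graph_mixture) tt.

HB.instance Definition _ := Measure.on joint.

Lemma ge0_integral_joint (f : X * Y -> \bar R) :
  (forall p, 0 <= f p)%E -> measurable_fun setT f ->
  (\int[joint]_p f p =
   \int[nu]_x \sum_(i < n) (weight M i x)%:E * f (x, atom M i x))%E.
Proof.
move=> f0 mf; rewrite /joint integral_kcomp//.
by apply: eq_integral => x _; rewrite ge0_integral_mix.
Qed.

Lemma jointE (C : set (X * Y)) :
  joint C = (\int[nu]_x mix_ker M x (xsection C x))%E.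
Proof.
rewrite /joint /kcomp; apply: eq_integral => x _; rewrite !mix_kerE.
by congr _%:E; apply: eq_bigr => i _; rewrite /= !indicE mem_xsection.
Qed.

Lemma joint_fst B : measurable B -> joint (fst @^-1` B) = nu B.
Proof.
move=> mB; rewrite jointE.
transitivity (\int[nu]_x (\1_B x)%:E)%E; last by rewrite integral_indic// setIT.
apply: eq_integral => x _; rewrite mix_kerE; congr _%:E.
rewrite -[RHS]mul1r -(weight_sum M x) mulr_suml; apply: eq_bigr => i _.
by rewrite !indicE mem_xsection; congr (_ * (nat_of_bool _)%:R); rewrite !inE.
Qed.

Let joint1 : joint setT = 1%E.
Proof. by have := joint_fst measurableT; rewrite preimage_setT probability_setT. Qed.

HB.instance Definition _ := Measure_isProbability.Build _ _ _ joint joint1.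

Definition joint_law : probability (X * Y)%type R := joint.

End joint.

Section second_moment.
Context d d' (X : measurableType d) (Y : measurableType d') (R : realType).
Context n (M M0 : mixture X Y R n) (nu : probability X R).
Context (dens : nat -> X -> R) (D c : R).
Hypothesis c0 : 0 < c.
Hypothesis same_atom : forall i, atom M i = atom M0 i.
Hypothesis weightE : forall i x, weight M i x = dens i x * weight M0 i x.
Hypothesis measurable_dens : forall i, measurable_fun setT (dens i).
Hypothesis dens_le : forall i x, `|dens i x| <= D.
Hypothesis second_moment :
  \int[nu]_x (\sum_(i < n) dens i x ^+ 2 * weight M0 i x) <= c.

Lemma weight_le1 (N : mixture X Y R n) (i : 'I_n) x : weight N i x <= 1.
Proof.
rewrite -(weight_sum N x) (bigD1 i)//= lerDl.
by apply: sumr_ge0 => j _; exact: weight_ge0.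
Qed.

Lemma Rintegral_joint (N : mixture X Y R n) (f : X * Y -> R) :
  (forall p, 0 <= f p) -> measurable_fun setT f ->
  \int[joint_law N nu]_p f p =
  \int[nu]_x (\sum_(i < n) weight N i x * f (x, atom N i x)).
Proof.
move=> f0 mf; rewrite /Rintegral; congr fine.
rewrite (ge0_integral_joint N nu (f := EFin \o f))//; last exact/measurable_EFinP.
by apply: eq_integral => x _; rewrite -sumEFin.
Qed.

Lemma measurable_atom_comp (N : mixture X Y R n) (f : X * Y -> R) i :
  measurable_fun setT f -> measurable_fun setT (fun x => f (x, atom N i x)).
Proof.
move=> mf; apply: (measurableT_comp mf); apply: measurable_fun_pair => //.
exact: measurable_atom.
Qed.

(** With [dens] the density, 2 dens f <= a dens^2 + a^-1 f^2 for every a > 0;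
integrate and take a := I / c, where I is the integral of [f]. *)
Lemma joint_second_moment (f : X * Y -> R) :
  (forall p, 0 <= f p <= 1) -> measurable_fun setT f ->
  (\int[joint_law M nu]_p f p) ^+ 2 <= c * \int[joint_law M0 nu]_p (f p ^+ 2).
Proof.
move=> f01 mf.
have f0 p : 0 <= f p by have /andP[] := f01 p.
have mf2 : measurable_fun setT (fun p => f p ^+ 2) by exact: measurable_funX.
rewrite !Rintegral_joint//; last by move=> p; exact: sqr_ge0.
set I := \int[nu]_x _; set J := \int[nu]_x _.
have iI : nu.-integrable setT
    (EFin \o (fun x => \sum_(i < n) weight M i x * f (x, atom M i x))).
  apply: (@bounded_integrable _ _ _ _ _ n%:R).
    apply: measurable_sum => i; apply: measurable_funM; first exact: measurable_weight.
    exact: measurable_atom_comp.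
  move=> x; apply: le_trans (ler_norm_sum _ _ _) _.
  rewrite -[n in n%:R]card_ord -sumr_const; apply: ler_sum => i _.
  rewrite normrM !ger0_norm ?weight_ge0// mulr_ile1 ?weight_ge0 ?weight_le1//.
  by have /andP[] := f01 (x, atom M i x).
have iJ : nu.-integrable setT
    (EFin \o (fun x => \sum_(i < n) weight M0 i x * f (x, atom M0 i x) ^+ 2)).
  apply: (@bounded_integrable _ _ _ _ _ n%:R).
    apply: measurable_sum => i; apply: measurable_funM; first exact: measurable_weight.
    exact: (measurable_atom_comp _ _ mf2).
  move=> x; apply: le_trans (ler_norm_sum _ _ _) _.
  rewrite -[n in n%:R]card_ord -sumr_const; apply: ler_sum => i _.
  rewrite normrM !ger0_norm ?weight_ge0 ?sqr_ge0// mulr_ile1 ?weight_ge0 ?weight_le1 ?sqr_ge0//.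
  by rewrite exprn_ile1//; have /andP[] := f01 (x, atom M0 i x).
have iD : nu.-integrable setT
    (EFin \o (fun x => \sum_(i < n) dens i x ^+ 2 * weight M0 i x)).
  apply: (@bounded_integrable _ _ _ _ _ (n%:R * D ^+ 2)).
    apply: measurable_sum => i; apply: measurable_funM; last exact: measurable_weight.
    exact: measurable_funX.
  move=> x; apply: le_trans (ler_norm_sum _ _ _) _.
  rewrite -[n in n%:R]card_ord mulr_natl -sumr_const; apply: ler_sum => i _.
  rewrite normrM ger0_norm ?sqr_ge0// ger0_norm ?weight_ge0//.
  rewrite -[leRHS]mulr1 ler_pM ?sqr_ge0 ?weight_ge0 ?weight_le1//.
  by rewrite -[leLHS]real_normK ?num_real// lerXn2r ?nnegrE ?(le_trans _ (dens_le i x)).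
have I0 : 0 <= I.
  by apply: Rintegral_ge0 => x _; apply: sumr_ge0 => i _; rewrite mulr_ge0 ?weight_ge0.
have J0 : 0 <= J.
  apply: Rintegral_ge0 => x _; apply: sumr_ge0 => i _.
  by rewrite mulr_ge0 ?weight_ge0// sqr_ge0.
have key (a : R) : 0 < a -> 2 * I <= a * c + a^-1 * J.
  move=> a0.
  apply: le_trans (_ : a * \int[nu]_x (\sum_(i < n) dens i x ^+ 2 * weight M0 i x) +
                       a^-1 * J <= _); last first.
    by rewrite lerD2r ler_wpM2l// ltW.
  rewrite -!RintegralZl// -RintegralD//; last 2 first.
  - exact: (integrableZl measurableT a iD).
  - exact: (integrableZl measurableT a^-1 iJ).
  apply: le_Rintegral => //.
  - exact: (integrableZl measurableT 2 iI).
  - exact: (integrableD measurableT (integrableZl measurableT a iD)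
      (integrableZl measurableT a^-1 iJ)).
  move=> x _; rewrite !mulr_sumr -big_split/=; apply: ler_sum => i _.
  rewrite weightE same_atom; have := weight_ge0 M0 i x.
  move: (dens i x) (weight M0 i x) (f (x, _)) => u w v w0.
  rewrite (_ : a * (u ^+ 2 * w) + a^-1 * (w * v ^+ 2) =
     2 * (u * w * v) + w * a^-1 * (a * u - v) ^+ 2); last first.
    by field; rewrite gt_eqF.
  by rewrite lerDl mulr_ge0 ?sqr_ge0// mulr_ge0// invr_ge0 ltW.
have [->|I1] := eqVneq I 0; first by rewrite expr0n/= mulr_ge0// ltW.
have I2 : 0 < I by rewrite lt_neqAle eq_sym I1.
have := key _ (divr_gt0 I2 c0); rewrite divfK ?gt_eqF// invf_div.
rewrite mulrDl mul1r lerD2l mulrAC ler_pdivlMr// -expr2; exact.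
Qed.

End second_moment.

(** * Many hypotheses against independent samples *)

Section iid_second_moment.
Context d (T : measurableType d) (R : realType).
Implicit Types P : probability T R.

Lemma iidS P m (E : set (m.+1.-tuple T)) :
  iid P m.+1 E = (\int[P]_z iid P m [set s : m.-tuple T | E [tuple of z :: s]])%E.
Proof.
rewrite /= /pushforward /product_measure1; apply: eq_integral => z _ /=.
by congr (iid P m _); apply/seteqP; split => s /=; rewrite /xsection /= inE.
Qed.

Lemma measurable_cons_section m (E : set (m.+1.-tuple T)) : measurable E ->
  measurable [set p : T * m.-tuple T | E [tuple of p.1 :: p.2]].
Proof.
move=> mE; rewrite -[X in measurable X]setTI.
exact: (@measurable_cons _ _ (T * m.-tuple T)%type T fst m snd
  measurable_fst measurable_snd measurableT E mE).
Qed.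

Lemma measurable_iid_section P m (E : set (m.+1.-tuple T)) : measurable E ->
  measurable_fun setT (fun z => fine (iid P m [set s : m.-tuple T | E [tuple of z :: s]])).
Proof.
move=> mE; apply: (@measurableT_comp _ _ _ _ _ _ (@fine R) setT
  (fun z => iid P m [set s : m.-tuple T | E [tuple of z :: s]])).
  exact: fine_measurable.
have := measurable_fun_xsection (iid P m) (measurable_cons_section mE).
rewrite (_ : _ \o _ = fun z => iid P m [set s : m.-tuple T | E [tuple of z :: s]])//.
by apply/funext => z /=; congr (iid P m _); apply/seteqP; split => s /=;
  rewrite /xsection /= inE.
Qed.

Lemma measurable_iid_slice m (E : set (m.+1.-tuple T)) z : measurable E ->
  measurable [set s : m.-tuple T | E [tuple of z :: s]].
Proof.
move=> /measurable_cons_section/(measurable_xsection z).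
by congr measurable; apply/seteqP; split => s /=; rewrite /xsection /= inE.
Qed.

Lemma fine_prob_itv d' (S : measurableType d') (Q : probability S R) E :
  measurable E -> 0 <= fine (Q E) <= 1.
Proof.
move=> mE; rewrite fine_ge0//= -lee_fin fineK ?fin_num_measure//.
exact: probability_le1.
Qed.

Lemma fine_iidS P m (E : set (m.+1.-tuple T)) : measurable E ->
  fine (iid P m.+1 E) = \int[P]_z fine (iid P m [set s : m.-tuple T | E [tuple of z :: s]]).
Proof.
move=> mE; rewrite iidS /Rintegral; congr fine; apply: eq_integral => z _.
by rewrite fineK// fin_num_measure//; exact: measurable_iid_slice.
Qed.

Variables (P P0 : probability T R) (c : R).
Hypothesis c0 : 0 < c.
Hypothesis second_moment : forall f : T -> R, (forall z, 0 <= f z <= 1) ->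
  measurable_fun setT f -> (\int[P]_z f z) ^+ 2 <= c * \int[P0]_z (f z ^+ 2).

(** Sets rather than densities are carried through the induction: slicing the event
by its first draw, the inductive hypothesis bounds the square of the conditional
probability, and the one-draw inequality applied to the conditional probability
itself gives one more factor [c]. *)
Lemma iid_second_moment m (E : set (m.-tuple T)) : measurable E ->
  fine (iid P m E) ^+ 2 <= c ^+ m * fine (iid P0 m E).
Proof.
elim: m E => [|m IH] E mE.
  rewrite expr0 mul1r /= /dirac indicE.
  by case: (_ \in _); rewrite /= ?expr1n ?expr0n.
rewrite !fine_iidS//; set F := fun z => fine (iid P m [set s : m.-tuple T | E [tuple of z :: s]]).
set F0 := fun z => fine (iid P0 m [set s : m.-tuple T | E [tuple of z :: s]]).
have mF : measurable_fun setT F by exact: measurable_iid_section.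
have mF0 : measurable_fun setT F0 by exact: measurable_iid_section.
have F01 z : 0 <= F z <= 1 by apply: fine_prob_itv; exact: measurable_iid_slice.
have F001 z : 0 <= F0 z <= 1 by apply: fine_prob_itv; exact: measurable_iid_slice.
apply: le_trans (second_moment F01 mF) _.
rewrite exprS -mulrA ler_wpM2l//; first exact: ltW.
have iF0 : P0.-integrable setT (EFin \o F0).
  apply: (@bounded_integrable _ _ _ _ _ 1) => // z; have /andP[F0z F1z] := F001 z.
  by rewrite ger0_norm.
rewrite -RintegralZl//; apply: le_Rintegral => //.
- apply: (@bounded_integrable _ _ _ _ _ 1) => [|z]; first exact: measurable_funX.
  have /andP[Fz F1z] := F01 z; by rewrite ger0_norm ?sqr_ge0// exprn_ile1.
- exact: (integrableZl measurableT (c ^+ m) iF0).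
- move=> z _; apply: IH; exact: measurable_iid_slice.
Qed.

End iid_second_moment.

Section outer_cover.
Context d (T : measurableType d) (R : realType) (mu : {measure set T -> \bar R}).

Lemma mu_ext_cover (B : set T) (r : \bar R) : (mu_ext mu B < r)%E ->
  exists U, [/\ measurable U, B `<=` U & (mu U <= r)%E].
Proof.
move=> /ereal_inf_lt[_ [A [mA BA] <-] lt_r].
exists (\bigcup_i A i); split => //; first exact: bigcupT_measurable.
apply: le_trans (ltW lt_r).
apply: measure_sigma_subadditive => //; exact: bigcupT_measurable.
Qed.

Lemma mu_ext_le_setT (B : set T) : (mu_ext mu B <= mu setT)%E.
Proof.
apply: ereal_inf_lbound.
exists (fun i => if i is 0%N then setT else set0).
  split; first by case.
  by move=> x _; exists 0%N.
rewrite (nneseries_split 0%N 1%N)//= ?big_nat1 ?eseries0 ?adde0//.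
by case=> // i; rewrite measure0.
Qed.

End outer_cover.

Section minimax_lower_bound.
Context d (T : measurableType d) (R : realType) (H : normedModType R).

Lemma sum_prob_le d' (S : measurableType d') (Q : probability S R) (J : finType)
  (E : J -> set S) (V : R) : (forall j, measurable (E j)) ->
  (forall z, \sum_(j : J) (\1_(E j) z : R) <= V) ->
  \sum_(j : J) fine (Q (E j)) <= V.
Proof.
move=> mE EV.
rewrite -lee_fin -sumEFin.
under eq_bigr do rewrite fineK ?fin_num_measure// -[E _]setIT -integral_indic//.
rewrite -ge0_integral_sum//=; last first.
  by move=> j; apply/measurable_EFinP; exact: measurable_indic.
apply: le_trans (_ : \int[Q]_z (V%:E) <= _)%E.
  apply: ge0_le_integral => //=.
  - by move=> z _; apply: sume_ge0.
  - by apply: emeasurable_sum => j; apply/measurable_EFinP; exact: measurable_indic.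
  - by move=> z _; rewrite sumEFin lee_fin.
have QT := probability_setT Q; rewrite integral_cst// -[leRHS]mule1 -QT; exact: lexx.
Qed.

(** Algorithms need not be measurable: each event of failure is enclosed in a
measurable set of nearly the same outer measure, and the complements of these sets
are measurable events of success, of probability at least [q] if the risk is below
1 - q.  They overlap at most [V] times, so their probabilities under [P0] sum to at
most [V]. *)
Lemma minimax_risk_ge (C : set (probability T R * H)) (m : nat) (r : R)
  (J : finType) (P : J -> probability T R) (f : J -> H) (P0 : probability T R)
  (c V q : R) :
  (forall j, C (P j, f j)) -> 0 < c ->
  (forall j (g : T -> R), (forall z, 0 <= g z <= 1) -> measurable_fun setT g ->
    (\int[P j]_z g z) ^+ 2 <= c * \int[P0]_z (g z ^+ 2)) ->
  (forall v : H, (#|[set j | `|v - f j| <= r]%SET|)%:R <= V) ->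
  0 <= q -> c ^+ m * V < #|J|%:R * q ^+ 2 ->
  ((1 - q)%:E <= minimax_risk C m r)%E.
Proof.
move=> CP c0 sm Vle q0 small; apply: le_ereal_inf_tmp => _ [l _ <-].
rewrite leNgt; apply/negP => sup_lt.
have cover j : exists U, [/\ measurable U, [set z | r < `|l m z - f j|] `<=` U &
    (iid (P j) m U <= (1 - q)%:E)%E].
  apply: mu_ext_cover; apply: le_lt_trans sup_lt.
  by apply: ereal_sup_ubound; exists (P j, f j).
have /choice[U UP] := cover.
have mE j : measurable (~` U j) by apply: measurableC; case: (UP j).
have q_le j : q <= fine (iid (P j) m (~` U j)).
  have [mU _ Uq] := UP j.
  rewrite probability_setC// fineB ?fin_num_measure//= lerBrDl -lerBrDr.
  by rewrite -lee_fin fineK ?fin_num_measure.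
have : #|J|%:R * q ^+ 2 <= c ^+ m * V; last by rewrite leNgt small.
rewrite mulrC mulr_natr -sumr_const.
apply: le_trans (_ : \sum_(j : J) c ^+ m * fine (iid P0 m (~` U j)) <= _).
  apply: ler_sum => j _; apply: le_trans (iid_second_moment c0 (sm j) (mE j)).
  by rewrite lerXn2r ?nnegrE// (le_trans q0).
rewrite -mulr_sumr ler_wpM2l ?exprn_ge0 1?(ltW c0)//.
apply: (sum_prob_le (iid P0 m) (E := fun j => ~` U j)) => // z; apply: le_trans (Vle (l m z)).
rewrite -sum1_card natr_sum [leRHS]big_mkcond /=; apply: ler_sum => j _.
rewrite inE indicE; case: ifPn => [_|]; first by case: (_ \in _).
rewrite -ltNge => far; have [_ BU _] := UP j.
by rewrite memNset//= => /(_ _); apply; exact: BU.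
Qed.

End minimax_lower_bound.

(** * Hamming balls *)

Section hamming.
Context (R : realType) (l : nat).
Implicit Types s t : {ffun 'I_l -> bool}.

Definition hamming s t := (\sum_(i < l) (s i != t i))%N.

(** Chernoff's bound: \sum_s x ^+ hamming s t = (1 + x) ^+ l, and with x = 1/4 each
term of the ball is at least (1/4) ^+ (l/4). *)
Lemma hamming_ball_card t :
  (#|[set s | (4 * hamming s t <= l)%N]%SET|)%:R <= (9 / 5 : R) ^+ l.
Proof.
have gen (x : R) : \sum_(s : {ffun 'I_l -> bool}) x ^+ hamming s t = (1 + x) ^+ l.
  transitivity (\sum_(s : {ffun 'I_l -> bool}) \prod_(i < l) x ^+ (s i != t i)).
    by apply: eq_bigr => s _; rewrite /hamming; elim/big_rec2: _ => [|i a b _ <-];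
      rewrite ?expr0// exprD.
  rewrite -(bigA_distr_bigA (fun (i : 'I_l) (b : bool) => x ^+ (b != t i))).
  rewrite (eq_bigr (fun=> 1 + x)) ?prodr_const ?card_ord// => i _.
  by rewrite big_bool/=; case: (t i); rewrite /= ?expr0 ?expr1// addrC.
set B := [set s | _]%SET.
(* z ^+ 4 = 1/4, so that (1/4)^(l/4) = z ^+ l; and 5/4 <= 9/5 z *)
pose z := Num.sqrt (2^-1 : R).
have z0 : 0 < z by rewrite sqrtr_gt0.
have z2 : z ^+ 2 = 2^-1 by rewrite sqr_sqrtr.
have z1 : z <= 1 by rewrite -(ler_pXn2r (_ : 0 < 2)%N) ?nnegrE ?ltW// expr1n z2; lra.
have z3 : 25 / 36 <= z.
  by rewrite -(ler_pXn2r (_ : 0 < 2)%N) ?nnegrE ?ltW// z2; lra.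
have zle : (#|B|)%:R * z ^+ l <= (5 / 4 : R) ^+ l.
  have -> : (5 / 4 : R) = 1 + z ^+ 4.
    by rewrite (exprM z 2 2) z2; field.
  rewrite -gen mulr_natl -sumr_const [leRHS](bigID (mem B))/= -[leLHS]addr0.
  apply: lerD; last by apply: sumr_ge0 => s _; rewrite exprn_ge0// exprn_ge0// ltW.
  apply: ler_sum => s; rewrite inE => sB.
  by rewrite -exprM ler_wiXn2l// ltW.
rewrite -(ler_pM2r (exprn_gt0 l z0)) -exprMn; apply: le_trans zle _.
by apply: lerXn2r; rewrite ?nnegrE; lra.
Qed.

End hamming.

(** * The tilted two-point noise *)

Section noise.
Context d (T : measurableType d) (R : realType) (Y : hilbertType R).

Lemma big_ord_double (n : nat) (F : nat -> R) :
  \sum_(i < n.*2) F i = \sum_(j < n) (F j.*2 + F j.*2.+1).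
Proof.
elim: n => [|n IH]; first by rewrite !big_ord0.
by rewrite doubleS 2!big_ord_recr/= IH big_ord_recr/= addrA.
Qed.

Variables (e : nat -> Y) (N : nat).
Hypothesis be : orthonormal_basis e.
Hypothesis eN : forall j, (N < j)%N -> e j = 0.
Hypothesis sepY : separable Y.
Variables (u h : T -> Y) (s : R).
Hypothesis s0 : 0 < s.
Hypothesis mu : forall v, measurable_fun setT (fun x => inner (u x) v).
Hypothesis mh : forall v, measurable_fun setT (fun x => inner (h x) v).
Hypothesis h_le : forall x, N.+1%:R * `|h x| <= s.

Lemma norm_e_le1 j : `|e j| <= 1.
Proof.
rewrite -(ler_pXn2r (_ : 0 < 2)%N) ?nnegrE// expr1n.
exact: norm_semi_orthonormal_le1 (orthonormal_basis_semi be).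
Qed.

Definition noise_sign (i : nat) : R := (-1) ^+ odd i.

(** Atoms [2j] and [2j+1] are [u x + s e_j] and [u x - s e_j].  At the atom y the
density is 1 + (N + 1) / s^2 <h x, y - u x>, the tilt that moves the mean from
[u x] to [u x + h x]. *)
Definition noise_dens i x : R :=
  1 + noise_sign i * (N.+1%:R * inner (h x) (e i./2) / s).

Lemma noise_shift_le1 i x : `|N.+1%:R * inner (h x) (e i./2) / s| <= 1.
Proof.
rewrite normrM normrM (ger0_norm (ltW (_ : 0 < s^-1))) ?invr_gt0//.
rewrite ler_pdivrMr// mul1r normr_nat; apply: le_trans (h_le x).
rewrite ler_wpM2l//; apply: le_trans (cauchy_schwarz _ _) _.
by rewrite -[leRHS]mulr1 ler_wpM2l// norm_e_le1.
Qed.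

Lemma noise_dens_ge0 i x : 0 <= noise_dens i x.
Proof.
have := noise_shift_le1 i x; rewrite ler_norml /noise_dens /noise_sign.
by case: (odd i) => /=; rewrite ?expr0 ?expr1 ?mul1r ?mulN1r => /andP[]; lra.
Qed.

Lemma noise_dens_le2 i x : `|noise_dens i x| <= 2.
Proof.
apply: le_trans (ler_normD _ _) _; rewrite normr1 normrM /noise_sign.
rewrite normr_sign mul1r; have := noise_shift_le1 i x; lra.
Qed.

Lemma measurable_noise_dens i : measurable_fun setT (noise_dens i).
Proof.
apply: measurable_funD => //; apply: measurable_funM => //.
by apply: measurable_funM => //; apply: measurable_funM => //; exact: mh.
Qed.

Lemma double_inv : (N.+1.*2%:R^-1 : R) = 2^-1 * N.+1%:R^-1.
Proof. by rewrite -muln2 natrM invfM mulrC. Qed.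

Definition noise_atom i x : borel Y := u x + (noise_sign i * s) *: e i./2.

Program Definition noise_mixture : mixture T (borel Y) R N.+1.*2 := {|
  atom := noise_atom ;
  weight := fun i x => noise_dens i x * N.+1.*2%:R^-1 |}.
Next Obligation.
move=> i; apply: (measurable_coord sepY be eN) => j.
under eq_fun do rewrite innerDl.
by apply: measurable_funD => //; exact: mu.
Qed.
Next Obligation.
by move=> i; apply: measurable_funM => //; exact: measurable_noise_dens.
Qed.
Next Obligation. by move=> i x; rewrite mulr_ge0 ?noise_dens_ge0// invr_ge0. Qed.
Next Obligation.
move=> x; change (\sum_(i < N.+1.*2) noise_dens i x * N.+1.*2%:R^-1 = 1).
rewrite (big_ord_double _ (fun i => noise_dens i x * N.+1.*2%:R^-1)).
rewrite -(big_mkord xpredT (fun j => noise_dens j.*2 x * N.+1.*2%:R^-1 +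
  noise_dens j.*2.+1 x * N.+1.*2%:R^-1)) (eq_bigr (fun=> N.+1%:R^-1)).
  by rewrite sumr_const_nat subn0 -[LHS]mulr_natr mulVf ?pnatr_eq0.
move=> j _; rewrite /noise_dens /noise_sign /= odd_double doubleK uphalf_double.
by rewrite double_inv expr0 expr1; field; rewrite ?pnatr_eq0 ?gt_eqF.
Qed.

Lemma noise_weight_pairs x : \sum_(j < N.+1)
  (noise_dens j.*2 x * N.+1.*2%:R^-1 + noise_dens j.*2.+1 x * N.+1.*2%:R^-1) = 1.
Proof.
rewrite -(big_ord_double _ (fun i => noise_dens i x * N.+1.*2%:R^-1)).
exact: (weight_sum noise_mixture x).
Qed.

Lemma noise_mean x v :
  \sum_(i < N.+1.*2) noise_dens i x * N.+1.*2%:R^-1 * inner (noise_atom i x) v =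
  inner (u x + h x) v.
Proof.
rewrite (big_ord_double _
  (fun i => noise_dens i x * N.+1.*2%:R^-1 * inner (noise_atom i x) v)).
rewrite innerDl (finite_parseval (h x) v be eN).
transitivity (1 * inner (u x) v + \sum_(j < N.+1) inner (h x) (e j) * inner v (e j));
  last by rewrite mul1r.
rewrite -[X in _ = X * _ + _](noise_weight_pairs x) mulr_suml -big_split/=.
apply: eq_bigr => j _; rewrite /noise_dens /noise_atom /noise_sign /=.
rewrite odd_double doubleK uphalf_double !innerDl !innerZl double_inv expr0 expr1.
rewrite (innerC v); field.
by rewrite nat1r pnatr_eq0 (gt_eqF s0).
Qed.

Lemma noise_dist i x : `|noise_atom i x - (u x + h x)| <= 2 * s.
Proof.
rewrite /noise_atom opprD addrACA subrr add0r.
apply: le_trans (ler_normB _ _) _; rewrite normrZ normrM normr_sign mul1r.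
have hs : `|h x| <= s.
  apply: le_trans (h_le x); rewrite ler_peMl// ler1n//.
have := norm_e_le1 i./2; rewrite gtr0_norm// => e1.
have : s * `|e i./2| <= s * 1 by rewrite ler_wpM2l// ltW.
lra.
Qed.

Lemma noise_second_moment x :
  \sum_(i < N.+1.*2) noise_dens i x ^+ 2 * N.+1.*2%:R^-1 =
  1 + N.+1%:R / s ^+ 2 * inner (h x) (h x).
Proof.
rewrite (big_ord_double _ (fun i => noise_dens i x ^+ 2 * N.+1.*2%:R^-1)).
rewrite (finite_parseval (h x) (h x) be eN) mulr_sumr.
rewrite -[X in _ = X + _](noise_weight_pairs x) -big_split/=.
apply: eq_bigr => j _; rewrite /noise_dens /noise_sign /=.
rewrite odd_double doubleK uphalf_double double_inv expr0 expr1.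
field.
by rewrite nat1r pnatr_eq0 (gt_eqF s0).
Qed.

End noise.

(** * The laws attached to the candidate solutions *)

Section exponential_bound.
Context (R : realType).

(** From exp(-x) >= 1 - x, that is exp(x) <= 1 / (1 - x). *)
Lemma expR_sub_le (x : R) : 0 <= x <= 2^-1 -> expR x - x - 1 <= 2 * x ^+ 2.
Proof.
move=> /andP[x0 x2].
have : expR x * (1 - x) <= 1.
  have e : expR x * expR (- x) = 1 by rewrite -expRD subrr expR0.
  rewrite -[leRHS]e ler_wpM2l ?expR_ge0//; exact: expR_ge1Dx.
have := expR_ge1Dx x.
move: (expR x) => y; nra.
Qed.

Lemma exp_moment_le (M Sigma s y : R) : 0 < M -> 0 <= y -> y <= 2 * s ->
  4 * s <= M -> 4 * s <= Sigma ->
  expR (y / M) - y / M - 1 <= Sigma ^+ 2 / (2 * M ^+ 2).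
Proof.
move=> M0 y0 ys sM sS.
have yM : 0 <= y / M <= 2^-1.
  by rewrite (divr_ge0 y0 (ltW M0))/= ler_pdivrMr//; lra.
apply: le_trans (expR_sub_le yM) _.
have -> : 2 * (y / M) ^+ 2 = (2 * y) ^+ 2 / (2 * M ^+ 2).
  by field; rewrite gt_eqF.
rewrite ler_wpM2r ?invr_ge0 ?mulr_ge0 ?exprn_ge0 ?(ltW M0)//.
by apply: lerXn2r; rewrite ?nnegrE; lra.
Qed.

End exponential_bound.

(** A law whose first marginal agrees with [nu] on Borel sets has the operators of
[nu], although the two measures may differ as functions of arbitrary sets. *)
Section same_marginal.
Context (R : realType) (X : completePseudoMetricType R) (Y H1 H2 : hilbertType R).
Context (ev : H2 -> X -> Y) (A : H1 -> H2) (nu nu' : probability (borel X) R).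
Hypothesis nuE : forall B, measurable B -> nu' B = nu B.

Lemma eq_prob_integral (f : X -> \bar R) :
  (\int[nu']_x f x = \int[nu]_x f x)%E.
Proof. by apply: eq_measure_integral => B mB _; exact: nuE. Qed.

Lemma eq_LK : LK ev nu' = LK ev nu.
Proof.
rewrite /LK; congr (_ \o _); rewrite /IK_adjoint; congr (xget _ _).
apply/seteqP.
split=> J /= JP u h [mu Lu].
  rewrite JP; first by rewrite /Rintegral eq_prob_integral.
  by split => //; rewrite /L2_sqnorm eq_prob_integral.
rewrite JP; first by rewrite /Rintegral eq_prob_integral.
by split => //; rewrite /L2_sqnorm -eq_prob_integral.
Qed.

Lemma eq_Top f : Top ev A nu' f = Top ev A nu f.
Proof. by rewrite /Top eq_LK. Qed.

End same_marginal.

Section perturbed_laws.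
Context (R : realType) (X : completePseudoMetricType R) (Y H1 H2 : hilbertType R).
Context (ev : H2 -> X -> Y) (K : X -> X -> Y -> Y) (K_ : X -> Y -> H2).
Hypothesis kerK : kernel_assumption ev K K_.
Hypothesis sepY : separable Y.
Hypothesis dimY : finite_dimensional Y.
Context (D : set H1) (A : H1 -> H2) (fbar : H1) (nu : probability (borel X) R).
Context (phi : R -> R) (M Sigma Rad beta b : R).
Hypotheses (M0 : 0 < M) (Sigma0 : 0 < Sigma).
Hypothesis eigLK : exists2 t, eigenvalues (LK ev nu) t &
  forall n, t n <= beta * n.+1%:R `^ (- b).
Let Z := (borel X * borel Y)%type.

(** [eta] keeps the tilt of the noise below 1; it exists because the elements of the
kernel space are bounded functions, uniformly on bounded sets. *)
Lemma perturbed_laws : exists (P0 : probability Z R) (eta c : R),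
  [/\ 0 < eta, 0 <= c & forall f, D° f -> `|A f - A fbar| <= eta ->
    (exists2 g, f - fbar = opfun phi (Top ev A nu f) g & `|g| <= Rad) ->
    exists P : probability Z R,
      class_P ev A D fbar phi M Sigma Rad beta b (P, f) /\
      forall g : Z -> R, (forall z, 0 <= g z <= 1) -> measurable_fun setT g ->
        (\int[P]_z g z) ^+ 2 <=
        (1 + c * \int[nu]_x inner (ev (A f - A fbar) x) (ev (A f - A fbar) x)) *
        \int[P0]_z (g z ^+ 2)].
Proof.
have [e [N [k [be eN' k0 evk]]]] := ev_bounded kerK dimY.
have eN j : (N < j)%N -> e j = 0 by move=> /ltnW; exact: eN'.
(* the noise, at most 2 s, must have an exponential moment below that allowed by M, Sigma *)
pose s := Num.min M Sigma / 4.
have s0 : 0 < s by rewrite divr_gt0// lt_min M0.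
have sM : 4 * s <= M by rewrite mulrC divfK// ge_min lexx.
have sS : 4 * s <= Sigma by rewrite mulrC divfK// ge_min lexx orbT.
pose u (x : borel X) := ev (A fbar) x.
have mu v : measurable_fun setT (fun x => inner (u x) v) by exact: (measurable_inner_ev kerK).
have m0 v : measurable_fun setT (fun x : borel X => inner ((fun=> 0 : Y) x) v).
  by under eq_fun do rewrite inner0l; exact: measurable_cst.
have h0 (x : borel X) : N.+1%:R * `|(0 : Y)| <= s by rewrite normr0 mulr0 ltW.
pose mix0 := noise_mixture be eN sepY s0 mu m0 h0.
exists (joint_law mix0 nu), (s / (N.+1%:R * (k + 1))), (N.+1%:R / s ^+ 2).
have k1 : 0 < k + 1 by rewrite ltr_wpDl.
split; [by rewrite divr_gt0// mulr_gt0|by rewrite divr_ge0 ?exprn_ge0// ltW|].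
move=> f Df Af source.
pose h (x : borel X) := ev (A f - A fbar) x.
have uh x : u x + h x = ev (A f) x by rewrite /u /h (evB kerK) addrC subrK.
have mh v : measurable_fun setT (fun x => inner (h x) v) by exact: (measurable_inner_ev kerK).
have hle x : N.+1%:R * `|h x| <= s.
  have Nk : 0 < N.+1%:R * (k + 1) by rewrite mulr_gt0.
  have := Af; rewrite ler_pdivlMr// mulrC => /(le_trans _); apply.
  rewrite -mulrA ler_wpM2l//; apply: le_trans (evk _ _) _.
  by rewrite ler_wpM2r// lerDl.
pose mix := noise_mixture be eN sepY s0 mu mh hle.
exists (joint_law mix nu); split; last first.
  move=> g g01 mg.
  apply: (joint_second_moment (dens := noise_dens e N h s) (D := 2)) => //.
  - by rewrite ltr_wpDr// mulr_ge0 ?divr_ge0 ?exprn_ge0 1?(ltW s0)//;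
      apply: Rintegral_ge0 => x _; rewrite inner_norm exprn_ge0.
  - move=> i x /=; rewrite /noise_dens inner0l mulr0 mul0r mulr0 addr0 mul1r.
    by [].
  - by move=> i; exact: measurable_noise_dens.
  - by move=> i x; apply: noise_dens_le2.
  - have -> : (fun x : borel X => \sum_(i < N.+1.*2)
        noise_dens e N h s i x ^+ 2 * weight mix0 i x) =
      fun x => 1 + N.+1%:R / s ^+ 2 * inner (h x) (h x).
      apply/funext => x; rewrite -(noise_second_moment be eN sepY s0 mu mh hle).
      apply: eq_bigr => i _ /=; congr (_ * _).
      by rewrite /noise_dens inner0l mulr0 mul0r mulr0 addr0 mul1r.
    have ih := integrable_ev2 kerK dimY nu (A f - A fbar) (A f - A fbar).
    rewrite RintegralD//; last 2 first.
    + exact: finite_measure_integrable_cst.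
    + exact: (integrableZl measurableT (N.+1%:R / s ^+ 2) ih).
    have -> : \int[nu]_x (1 : R) = 1.
      rewrite Rintegral_cst// mul1r.
      exact: (congr1 fine (probability_setT nu)).
    by rewrite RintegralZl.
have nuE B : measurable B -> marginal (joint_law mix nu) B = nu B.
  by move=> mB; apply: joint_fst.
split.
- by [].
- exists (mix_ker mix).
    move=> C mC; rewrite (eq_prob_integral nuE); exact: jointE.
  split => [x|].
    split.
      apply/integrableP; split.
        by apply/measurable_EFinP; apply: continuous_borel; exact: norm_continuous.
      rewrite ge0_integral_mix//.
        rewrite (eq_bigr (fun i : 'I__ =>
          (weight mix i x * `| `|atom mix i x : Y| |)%:E))//.
        by rewrite sumEFin ltry.
      apply: measurableT_comp => //; apply/measurable_EFinP.
      by apply: continuous_borel; exact: norm_continuous.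
    move=> v; rewrite /Rintegral integral_mix/=.
      rewrite -uh -(noise_mean be eN sepY s0 mu mh hle x v)//.
    by under eq_fun do rewrite innerC; apply: continuous_borel; exact: continuous_innerl.
  apply: aeW => x.
  rewrite integral_mix; last first.
    apply: continuous_borel => y; apply: cvgB; last exact: cvg_cst.
    have cn : (fun y : Y => `|y - ev (A f) x| / M) y' @[y' --> y] --> `|y - ev (A f) x| / M.
      apply: cvgM; last exact: cvg_cst.
      by apply: cvg_norm; apply: cvgB; [exact: cvg_id|exact: cvg_cst].
    apply: cvgB => //; apply: continuous_cvg => //; exact: continuous_expR.
  rewrite lee_fin; apply: le_trans (_ : \sum_(i < N.+1.*2) weight mix i x *
      (Sigma ^+ 2 / (2 * M ^+ 2)) <= _); last first.
    by rewrite -mulr_suml weight_sum mul1r.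
  apply: ler_sum => i _; apply: ler_wpM2l; first exact: weight_ge0.
  have := noise_dist be u s0 hle i x; rewrite uh => dist.
  exact: (exp_moment_le M0 (normr_ge0 _) dist sM sS).
- by rewrite (eq_Top ev A nuE).
- by rewrite (eq_LK ev nuE).
Qed.

End perturbed_laws.

(** * The rate function and the dimension of the hypercube *)

Section rate_function.
Context (R : realType) (b : R) (phi : R -> R).
Hypothesis b1 : 1 < b.
Hypothesis phi_cont : {within `[0, +oo[, continuous phi}.
Hypothesis phi0 : phi 0 = 0.
Hypothesis phi_incr : {in `[0, +oo[ &, {homo phi : s t / s < t}}.

Let b0 : 0 < b. Proof. exact: lt_trans b1. Qed.

Lemma Psi_exp_gt0 : 0 < 2^-1 + (2 * b)^-1.
Proof. by rewrite addr_gt0// invr_gt0// mulr_gt0. Qed.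

Lemma Psi0 : Psi b phi 0 = 0.
Proof. by rewrite /Psi phi0 mulr0. Qed.

Lemma Psi_gt0 s : 0 < s -> 0 < Psi b phi s.
Proof. by move=> s0; rewrite mulr_gt0 ?powR_gt0// phi_gt0. Qed.

Lemma Psi_homo s t : 0 <= s -> s <= t -> Psi b phi s <= Psi b phi t.
Proof.
move=> s0 st; apply: ler_pM; rewrite ?powR_ge0//.
- by rewrite -[leLHS]phi0 phi_homo.
- by apply: (ge0_ler_powR (ltW Psi_exp_gt0)); rewrite ?nnegrE ?(le_trans s0).
- exact: phi_homo.
Qed.

(** Psi is continuous and increasing from 0, so its values fill an interval. *)
Lemma Psi_invP y : 0 < y -> y <= Psi b phi 1 ->
  0 < Psi_inv b phi y /\ Psi b phi (Psi_inv b phi y) = y.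
Proof.
move=> y0 y1.
have phi1 : 0 < phi 1 by exact: phi_gt0.
(* a left end point away from 0, where the power function is differentiable *)
have [c [c0 c1 cy]] : exists c, [/\ 0 < c, c <= 1 & Psi b phi c <= y].
  have /cvgr0Pnorm_lt/(_ _ (divr_gt0 y0 phi1)) pow0 := powR_cvg0 Psi_exp_gt0.
  near (0 : R)^'+ => c; exists c.
  have c0 : 0 < c by [].
  have c1 : c <= 1 by near: c; exact: nbhs_right_le.
  split => //; have : `|c `^ (2^-1 + (2 * b)^-1)| < y / phi 1 by near: c.
  rewrite ger0_norm ?powR_ge0// ltr_pdivlMr// => /ltW; apply: le_trans.
  by rewrite ler_wpM2l ?powR_ge0// phi_homo// ltW.
have cpow : {within `[c, 1], continuous (fun t : R => t `^ (2^-1 + (2 * b)^-1))}.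
  apply: derivable_within_continuous => z; rewrite in_itv/= => /andP[cz _].
  by apply: derivable_powR; rewrite in_itv/= (lt_le_trans c0).
have cphi : {within `[c, 1], continuous phi}.
  apply: (continuous_subspaceW _ phi_cont) => z /=.
  by rewrite !in_itv/= andbT => /andP[+ _]; apply: le_trans; exact: ltW.
have cP : {within `[c, 1], continuous (Psi b phi)}.
  by move=> x; apply: cvgM; [exact: cpow|exact: cphi].
have c1y : Num.min (Psi b phi c) (Psi b phi 1) <= y <= Num.max (Psi b phi c) (Psi b phi 1).
  by rewrite ge_min cy le_max y1 orbT.
have [z] := IVT c1 cP c1y; rewrite in_itv/= => /andP[cz _] zy.
have sj : set_surj `[0, +oo[ [set y] (Psi b phi).
  by move=> _ ->; exists z => //=; rewrite in_itv/= andbT (le_trans (ltW c0)).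
have PK : Psi b phi (Psi_inv b phi y) = y by apply: (surjpK (fun=> 0) sj); rewrite inE.
split => //; have /= : `[0, +oo[%classic (Psi_inv b phi y).
  by apply: (surjpinv_image_sub (dflt := fun=> 0) sj); exists y.
rewrite in_itv/= andbT le_eqVlt => /predU1P[s0|//].
by move: y0; rewrite -PK -s0 Psi0 ltxx.
Unshelve. all: by end_near. Qed.

(** With w := s^(1/b), so that m phi(s)^2 s = 1 / w by definition of Psi, the
dimension l is the integer part of x := alpha^(1/b) / (2 w); x lies between l and
2 l, and s = alpha (2x)^(-b). *)
Lemma sample_size_scaling alpha : 0 < alpha -> exists C1 C2 : R,
  [/\ 0 < C1, 0 < C2 & forall (eta : R) (L : nat), 0 < eta ->
    \forall m \near \oo, let s := Psi_inv b phi (m%:R `^ (- 2^-1)) in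
    [/\ 0 < s, s <= eta & exists l : nat,
    [/\ (L <= l)%N, (0 < l)%N,
        forall n, (n < l.*2)%N -> s <= alpha * n.+1%:R `^ (- b),
        forall n, (l <= n)%N -> n.+1%:R `^ (- b) <= C1 * s &
        m%:R * phi s ^+ 2 * s <= C2 * l%:R]]].
Proof.
move=> alpha0; pose a1 := alpha `^ b^-1.
have a10 : 0 < a1 by rewrite powR_gt0.
have a1b : a1 `^ b = alpha by rewrite -powRrM mulVf ?gt_eqF// powRr1// ltW.
exists (4 `^ b / alpha), (4 / a1).
split; [by rewrite divr_gt0// powR_gt0|by rewrite divr_gt0|move=> eta L eta0].
pose eta' := Num.min eta ((a1 / (2 * L.+1%:R)) `^ b).
have eta'0 : 0 < eta' by rewrite lt_min eta0 powR_gt0// divr_gt0// mulr_gt0.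
pose y := Num.min (Psi b phi 1) (Psi b phi eta').
have y0 : 0 < y by rewrite lt_min !Psi_gt0.
near=> m.
set s := Psi_inv b phi _.
have m0 : (0 < m)%N by near: m; exact: nbhs_infty_gt.
pose z := m%:R `^ (- 2^-1) : R.
have z0 : 0 < z by rewrite powR_gt0// ltr0n.
have z2 : z ^+ 2 = m%:R^-1.
  rewrite -powR_mulrn ?powR_ge0// -powRrM mulNr mulVf//.
  by rewrite powR_inv1// ler0n.
have zy : z < y.
  rewrite -(ltr_pXn2r (_ : 0 < 2)%N) ?nnegrE ?(ltW y0) ?(ltW z0)// z2.
  rewrite invf_plt ?posrE ?exprn_gt0 ?ltr0n//.
  by near: m; exact: nbhs_infty_gtr.
have [s0 sz] : 0 < s /\ Psi b phi s = z.
  by apply: Psi_invP => //; move: zy; rewrite lt_min => /andP[/ltW].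
have seta' : s <= eta'.
  rewrite leNgt; apply/negP => /ltW/(Psi_homo (ltW eta'0)).
  by rewrite sz leNgt; move: zy; rewrite lt_min => /andP[_ ->].
pose w := s `^ b^-1.
have w0 : 0 < w by rewrite powR_gt0.
have wb : w `^ b = s by rewrite -powRrM mulVf ?gt_eqF// powRr1// ltW.
split => //; first by move: seta'; rewrite le_min => /andP[].
have wle : w <= a1 / (2 * L.+1%:R).
  rewrite leNgt; apply/negP => /(gt0_ltr_powR b0).
  rewrite !nnegrE (ltW w0) ltW ?divr_gt0 ?mulr_gt0// wb => /(_ isT isT).
  by rewrite ltNge; move: seta'; rewrite le_min => /andP[_ ->].
pose x := a1 / (2 * w).
have xL : L.+1%:R <= x.
  rewrite ler_pdivlMr ?mulr_gt0//; move: wle; rewrite ler_pdivlMr ?mulr_gt0//.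
  by congr (_ <= _); ring.
have x0 : 0 <= x by rewrite (le_trans _ xL).
pose l := Num.truncn x.
have /andP[lx xl] : l%:R <= x < l.+1%:R by exact: truncn_itv.
have Ll : (L < l.+1)%N
  by rewrite -(ltr_nat R) (lt_le_trans _ (ltW xl))// (lt_le_trans _ xL)// ltr_nat.
have l0 : (0 < l)%N.
  by rewrite truncn_gt0 (le_trans _ xL)// ler1n.
have xl2 : x <= 2 * l%:R.
  apply: le_trans (ltW xl) _; rewrite -natr1 mulr_natl mulr2n lerD2l.
  by rewrite ler1n.
have powb n : 0 < n.+1%:R `^ b :> R by rewrite powR_gt0.
exists l; split => // [n nl|n ln|].
- have nw : n.+1%:R * w <= a1.
    have nx : n.+1%:R <= 2 * x.
      apply: le_trans (_ : (l.*2)%:R <= _); first by rewrite ler_nat.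
      by rewrite -mul2n natrM ler_wpM2l.
    rewrite -ler_pdivlMr//; apply: le_trans nx _.
    by rewrite le_eqVlt; apply/orP; left; apply/eqP; rewrite /x; field; rewrite gt_eqF.
  rewrite powRN ler_pdivlMr// -wb -a1b mulrC -powRM ?(ltW w0)//.
  by apply: (ge0_ler_powR (ltW b0)); rewrite ?nnegrE ?mulr_ge0 ?(ltW w0) ?(ltW a10).
- have nw : a1 <= 4 * (n.+1%:R * w).
    have : x <= 2 * n.+1%:R.
      by apply: le_trans xl2 _; rewrite ler_wpM2l// ler_nat (leq_trans ln).
    rewrite ler_pdivrMr ?mulr_gt0// => /le_trans; apply.
    by rewrite mulrACA -natrM.
  rewrite powRN -wb -a1b mulrAC ler_pdivlMr ?powR_gt0//.
  rewrite mulrC ler_pdivrMr// -powRM ?(ltW w0)//.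
  rewrite mulrC -powRM ?mulr_ge0 ?(ltW w0)//.
  apply: (ge0_ler_powR (ltW b0)); rewrite ?nnegrE ?mulr_ge0 ?(ltW w0) ?(ltW a10)//.
  by rewrite mulrCA.
- have mE : m%:R * phi s ^+ 2 * s = w^-1.
    have m1 : m%:R * z ^+ 2 = 1 by rewrite z2 mulfV// pnatr_eq0 -lt0n.
    have psi2 : Psi b phi s ^+ 2 = s * w * phi s ^+ 2.
      rewrite /Psi exprMn; congr (_ * _).
      rewrite -powR_mulrn ?powR_ge0// -powRrM mulrDl mulVf// powRD.
        rewrite powRr1 ?(ltW s0)// /w; congr (_ * _ `^ _).
        by rewrite invfM mulrAC mulVf// mul1r.
      by rewrite (gt_eqF s0) implybT.
    apply: (@mulIf _ w); first by rewrite gt_eqF.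
    rewrite mulVf ?gt_eqF//; transitivity (m%:R * z ^+ 2) => //.
    rewrite -sz psi2; ring.
  rewrite mE.
  have -> : w^-1 = 2 * x / a1.
    by rewrite /x; field; rewrite !gt_eqF.
  rewrite ler_pdivrMr// mulrAC divfK ?gt_eqF//.
  have -> : 4 = 2 * 2 :> R by rewrite -natrM.
  by rewrite -mulrA ler_wpM2l.
Unshelve. all: by end_near. Qed.

End rate_function.

(** * Consequences of the local assumptions on A *)

Section normal_operator.
Context (R : realType) (X : completePseudoMetricType R) (Y H1 H2 : hilbertType R).
Context (ev : H2 -> X -> Y) (A : H1 -> H2) (nu : probability (borel X) R) (f : H1).

Lemma adjoint0 (H G : hilbertType R) (S : H -> G) : adjoint S 0 = 0.
Proof.
rewrite /adjoint; case: xgetP => [S' _ /= S'P|//].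
by apply: inner_eq0; rewrite -S'P inner0r.
Qed.

Lemma Top_neq0_LK v : Top ev A nu f v <> 0 -> exists h, LK ev nu h <> 0.
Proof.
move=> Tv; apply: contrapT => /forallNP LK0; apply: Tv.
have {}LK0 h : LK ev nu h = 0 by exact: contrapT (LK0 h).
by rewrite /Top /= [X in adjoint _ X]LK0 adjoint0.
Qed.

(** As for [IK_adjointP], a nonzero value rules out the default value of [adjoint]. *)
Lemma Top_form v : Top ev A nu f v <> 0 -> forall u w,
  inner (Top ev A nu f u) w = inner (LK ev nu ('d A f u)) ('d A f w).
Proof.
rewrite /Top /= /adjoint; case: xgetP => [S' _ /= S'P _ u w|_ //].
by rewrite innerC -S'P innerC.
Qed.

End normal_operator.

Section orthonormal_sums.
Context (R : realType) (H : hilbertType R) (e : nat -> H).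
Hypothesis eo : forall i j, inner (e i) (e j) = (i == j)%:R.

Lemma inner_block l (a : 'I_l -> R) (i : 'I_l) :
  inner (\sum_(j < l) a j *: e (l + j)) (e (l + i)) = a i.
Proof.
rewrite inner_suml (bigD1 i)//= innerZl eo eqxx mulr1 big1 ?addr0// => j ji.
by rewrite innerZl eo eqn_add2l (negbTE (_ : j != i :> nat)) ?mulr0.
Qed.

Lemma norm_block l (a : 'I_l -> R) :
  `|\sum_(j < l) a j *: e (l + j)| ^+ 2 = \sum_(j < l) a j ^+ 2.
Proof.
rewrite -inner_norm inner_sumr; apply: eq_bigr => i _.
by rewrite innerZr inner_block expr2.
Qed.

End orthonormal_sums.

Section source_condition.
Context (R : realType) (H : hilbertType R).

(** The vector [g'] with R_f^* g' = g works since, by symmetry of [Sf],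
<Sf g', w> = <g', R_f (S w)> = <g, S w> for all w. *)
Lemma source_element (S Sf : H -> H) (Rf : {linear H -> H}) (q : R) (g u : H) :
  (forall v w, inner (Sf v) w = inner v (Sf w)) -> Sf = Rf \o S ->
  (forall h, `|Rf h - h| <= q * `|h|) -> 0 <= q -> q <= 2^-1 ->
  (forall w, inner g (S w) = inner u w) ->
  exists2 g', u = Sf g' & `|g'| <= 2 * `|g|.
Proof.
move=> sym SfE near_id q0 q2 gu.
have [g' g'g g'R] := adjoint_onto g near_id q0 q2.
exists g' => //; apply/eqP; rewrite -subr_eq0; apply/eqP/inner_eq0.
rewrite innerBl; apply/eqP; rewrite subr_eq0; apply/eqP.
by rewrite sym SfE /= g'R gu.
Qed.

End source_condition.

Section local_hypotheses.
Context (R : realType) (X : completePseudoMetricType R).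
Context (Y H1 H2 : hilbertType R).
Context (ev : H2 -> X -> Y) (K : X -> X -> Y -> Y) (K_ : X -> Y -> H2).
Hypotheses (sepY : separable Y) (dimY : finite_dimensional Y).
Hypothesis kerK : kernel_assumption ev K K_.
Context (D : set H1) (A : H1 -> H2) (fbar : H1) (delta : R).
Hypotheses (delta0 : 0 < delta) (ballD : ball fbar delta `<=` D).
Context (nu : probability (borel X) R).
Hypothesis diffA : forall f, D° f -> differentiable A f.
Context (gamma : R).
Hypothesis gamma0 : 0 <= gamma.
Hypothesis lipA : forall f f', (D `&` ball fbar delta) f ->
  (D `&` ball fbar delta) f' ->
  exists2 e : nat -> H1, orthonormal_basis e &
    (hs_sqnorm (L2_sqnorm nu)
       (fun h => IK ev ('d A f' h - 'd A f h)%R) e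
     <= ((gamma * `|f' - f|) ^+ 2)%R%:E)%E.
Context (t : nat -> R) (e : nat -> H1).
Hypothesis t_gt0 : forall n, 0 < t n.
Hypothesis eigT : eigensystem (Top ev A nu fbar) t e.

Local Notation T := (Top ev A nu fbar).
Local Notation B := (LK ev nu).

Lemma eigen_orthonormal i j : inner (e i) (e j) = (i == j)%:R.
Proof. by have [_ _ eo _] := eigT; apply: eo; rewrite gt_eqF. Qed.

Lemma Top_eigen n : T (e n) = t n *: e n.
Proof. by have [_ Te _ _] := eigT; apply: Te; rewrite gt_eqF. Qed.

Lemma Top_neq0 : T (e 0%N) <> 0.
Proof.
move=> T0; have := congr1 (fun v => inner v (e 0%N)) T0.
rewrite Top_eigen innerZl eigen_orthonormal eqxx mulr1 inner0l => /eqP.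
by rewrite gt_eqF.
Qed.

Lemma LK_formE h h' : inner (B h) h' = \int[nu]_x inner (ev h x) (ev h' x).
Proof. exact: IK_adjointP kerK sepY dimY _ (Top_neq0_LK Top_neq0) _ _. Qed.

Lemma LK_formC h h' : inner (B h) h' = inner (B h') h.
Proof. by rewrite !LK_formE; apply: eq_Rintegral => x _; rewrite innerC. Qed.

Lemma LK_form_ge0 h : 0 <= inner (B h) h.
Proof.
by rewrite LK_formE; apply: Rintegral_ge0 => x _; rewrite inner_norm exprn_ge0.
Qed.

Lemma Top_LK_form u w : inner (T u) w = inner (B ('d A fbar u)) ('d A fbar w).
Proof. exact: Top_form Top_neq0 u w. Qed.

Lemma T_symmetric u w : inner (T u) w = inner u (T w).
Proof. by rewrite Top_LK_form LK_formC -Top_LK_form innerC. Qed.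

Lemma ball_interior f : ball fbar delta f -> D° f.
Proof.
move=> bf; apply: (filterS ballD); apply: open_nbhs_nbhs; split => //.
exact: ball_open.
Qed.

(** The operator norm of I_K (A'(f) - A'(fbar)) is at most its Hilbert-Schmidt norm,
which is Lipschitz in f. *)
Lemma derivative_lipschitz f u : ball fbar delta f ->
  inner (B ('d A f u - 'd A fbar u)) ('d A f u - 'd A fbar u) <=
  (gamma * `|f - fbar|) ^+ 2 * `|u| ^+ 2.
Proof.
move=> bf; have bfbar : ball fbar delta fbar by exact: ballxx.
have [e1 be1 hs] := lipA (conj (ballD bfbar) bfbar) (conj (ballD bf) bf).
have dAf := diff_continuous (diffA (ball_interior bf)).
have dAfbar := diff_continuous (diffA (ball_interior bfbar)).
apply: (hilbert_schmidt_form_le LK_formC LK_form_ge0 (Q := fun h => 'd A f h - 'd A fbar h)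
  (e := e1)) => //.
- move=> a v w; rewrite (linearP ('d A f)) (linearP ('d A fbar)) scalerBr.
  by rewrite opprD addrACA.
- by move=> x; apply: cvgB; [exact: dAf|exact: dAfbar].
move=> n; rewrite -lee_fin; apply: le_trans hs; rewrite /hs_sqnorm.
rewrite -sumEFin; under eq_bigr do
  rewrite LK_formE -(L2_ev kerK sepY dimY nu _).2.
apply: nneseries_lim_ge => k _ _; apply: integral_ge0 => x _.
by rewrite lee_fin exprn_ge0.
Qed.

(** Linear part plus Taylor remainder; the quadratic form of the linear part is
<Tbar u, u>. *)
Lemma form_perturbation u : `|u| < delta ->
  inner (B (A (fbar + u) - A fbar)) (A (fbar + u) - A fbar) <=
  2 * inner (T u) u + 2 * (gamma ^+ 2 * `|u| ^+ 4).
Proof.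
move=> ud.
have bs (s : R) : 0 <= s <= 1 -> ball fbar delta (fbar + s *: u).
  move=> /andP[s0 s1]; rewrite -ball_normE /= opprD addNKr normrN normrZ ger0_norm//.
  by apply: le_lt_trans ud; rewrite ler_piMl.
have -> : A (fbar + u) - A fbar = (A (fbar + u) - A fbar - 'd A fbar u) + 'd A fbar u.
  by rewrite subrK.
apply: le_trans (formD_le LK_formC LK_form_ge0 _ _) _; rewrite addrC -Top_LK_form lerD2l ler_wpM2l//.
apply: (taylor_form LK_formC LK_form_ge0) => s s01.
  exact/diffA/ball_interior/bs.
apply: le_trans (derivative_lipschitz u (bs _ s01)) _.
rewrite addrAC subrr add0r normrZ; case/andP: s01 => s0 s1.
have -> : gamma ^+ 2 * `|u| ^+ 4 = (gamma * `|u|) ^+ 2 * `|u| ^+ 2 by ring.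
rewrite ger0_norm// ler_wpM2r ?exprn_ge0//.
rewrite lerXn2r ?nnegrE ?mulr_ge0// ler_wpM2l// ler_piMl//.
Qed.

Lemma separation_arith (x y d n : R) : 0 < n -> x * n = 4 * y -> 0 < y ->
  4 * x * d <= 4 * y -> 4 * d <= n.
Proof.
move=> n0 xn y0 le1; rewrite -(ler_pM2l y0).
have : 4 * x * d * n <= 4 * y * n by rewrite ler_wpM2r// ltW.
have -> : 4 * x * d * n = 4 * (x * n) * d by ring.
rewrite xn; lra.
Qed.

Section hypercube.
Context (phi : R -> R).
Hypothesis phi0 : phi 0 = 0.
Hypothesis phi_incr : {in `[0, +oo[ &, {homo phi : s t / s < t}}.
Context (l : nat) (r s C : R).
Hypotheses (l0 : (0 < l)%N) (r0 : 0 < r) (s0 : 0 < s).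
Hypothesis t_ge : forall i : 'I_l, s <= t (l + i).
Hypothesis t_le : forall i : 'I_l, t (l + i) <= C * s.
Implicit Types sg : {ffun 'I_l -> bool}.

Definition vertex_step : R := 2 * r / Num.sqrt l%:R.

Definition vertex_coef sg (i : 'I_l) : R := vertex_step * (-1) ^+ sg i.

Definition vertex sg : H1 := \sum_(i < l) vertex_coef sg i *: e (l + i).

Lemma vertex_step2 : vertex_step ^+ 2 * l%:R = 4 * r ^+ 2.
Proof.
have l1 : 0 < l%:R :> R by rewrite ltr0n.
rewrite /vertex_step expr_div_n sqr_sqrtr ?ler0n// divfK ?gt_eqF//; ring.
Qed.

Lemma vertex_coef2 sg i : vertex_coef sg i ^+ 2 = vertex_step ^+ 2.
Proof. by rewrite /vertex_coef exprMn sqrr_sign mulr1. Qed.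

Lemma norm_vertex sg : `|vertex sg| = 2 * r.
Proof.
apply/eqP; rewrite -(eqrXn2 (_ : 0 < 2)%N) ?mulr_ge0 ?(ltW r0)//.
rewrite /vertex (norm_block eigen_orthonormal).
rewrite (eq_bigr _ (fun i _ => vertex_coef2 sg i)) sumr_const card_ord.
by rewrite -[X in X == _]mulr_natr vertex_step2; apply/eqP; ring.
Qed.

Lemma form_vertex_le sg : inner (T (vertex sg)) (vertex sg) <= 4 * r ^+ 2 * (C * s).
Proof.
rewrite {2}/vertex inner_sumr -vertex_step2 mulrAC mulr_natr.
rewrite -[in leRHS](card_ord l) -sumr_const; apply: ler_sum => i _.
rewrite innerZr T_symmetric Top_eigen innerZr (inner_block eigen_orthonormal).
by rewrite mulrCA -expr2 vertex_coef2 mulrC ler_wpM2l ?sqr_ge0.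
Qed.

(** The squared distance of two vertices is 4 c^2 times their Hamming distance,
where c^2 l = 4 r^2. *)
Lemma vertex_separation v sg sg' :
  `|v - (fbar + vertex sg)| <= r -> `|v - (fbar + vertex sg')| <= r ->
  (4 * hamming sg sg' <= l)%N.
Proof.
move=> near near'.
have : `|vertex sg - vertex sg'| <= 2 * r.
  have -> : vertex sg - vertex sg' =
      (v - (fbar + vertex sg')) - (v - (fbar + vertex sg)).
    by rewrite opprB [RHS]addrC addrA subrK opprD addrACA subrr add0r.
  by apply: le_trans (ler_normB _ _) _; rewrite mulr_natl mulr2n lerD.
rewrite -(ler_pXn2r (_ : 0 < 2)%N) ?nnegrE ?mulr_ge0 ?(ltW r0)//.
have -> : vertex sg - vertex sg' =
    \sum_(i < l) (vertex_coef sg i - vertex_coef sg' i) *: e (l + i).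
  by rewrite /vertex -sumrB; apply: eq_bigr => i _; rewrite scalerBl.
rewrite (norm_block eigen_orthonormal).
have -> : \sum_(i < l) (vertex_coef sg i - vertex_coef sg' i) ^+ 2 =
    4 * vertex_step ^+ 2 * (hamming sg sg')%:R.
  rewrite /hamming natr_sum mulr_sumr; apply: eq_bigr => i _.
  rewrite /vertex_coef -mulrBr exprMn.
  by case: (sg i); case: (sg' i) => /=; rewrite ?expr0 ?expr1; ring.
have l1 : 0 < l%:R :> R by rewrite ltr0n.
have r2 : 0 < r ^+ 2 by rewrite exprn_gt0.
move: l1 vertex_step2 r2.
have -> : (2 * r) ^+ 2 = 4 * r ^+ 2 by ring.
rewrite -(ler_nat R) natrM.
exact: separation_arith.
Qed.

(** Divide the coordinates by phi(t_n), which is at least phi(s). *)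
Lemma vertex_source sg : exists2 g, forall w, inner g (opfun phi T w) = inner (vertex sg) w &
  `|g| <= 2 * r / phi s.
Proof.
have ps := phi_gt0 phi0 phi_incr s0.
exists (\sum_(i < l) (vertex_coef sg i / phi (t (l + i))) *: e (l + i)) => [w|].
  rewrite !inner_suml; apply: eq_bigr => i _; rewrite !innerZl.
  rewrite -opfun_symmetric (opfun_eigen phi0 phi_incr eigT T_symmetric (t_gt0 _) (Top_eigen _)).
  by rewrite innerZl mulrA divfK// gt_eqF// phi_gt0.
rewrite -(ler_pXn2r (_ : 0 < 2)%N) ?nnegrE ?divr_ge0 ?mulr_ge0 ?(ltW r0) ?(ltW ps)//.
rewrite (norm_block eigen_orthonormal (fun i => vertex_coef sg i / phi (t (l + i)))).
rewrite expr_div_n exprMn (_ : 2 ^+ 2 = 4 :> R); last by ring.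
rewrite -vertex_step2 mulrAC mulr_natr -[in leRHS](card_ord l) -sumr_const.
apply: ler_sum => i _; rewrite expr_div_n vertex_coef2 ler_wpM2l ?sqr_ge0//.
rewrite lef_pV2 ?posrE ?exprn_gt0 ?phi_gt0//.
by apply: lerXn2r; rewrite ?nnegrE ?(ltW ps) ?(ltW (phi_gt0 _ _ _))//;
  apply: (phi_homo phi_incr) => //; exact: ltW.
Qed.

End hypercube.

End local_hypotheses.

(** * The minimax lower bound *)

Section risk_limit.
Context (R : realType).

Lemma limn_einf_eq1 (u : nat -> \bar R) : (forall m, u m <= 1%:E)%E ->
  (forall q : R, 0 < q -> \forall m \near \oo, ((1 - q)%:E <= u m)%E) ->
  limn_einf u = 1%:E.
Proof.
move=> u1 uq; apply: (cvg_limn_einf_sup _).1.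
apply/fine_cvgP; split.
  have := uq 1 ltr01; apply: filterS => m; rewrite subrr => um.
  by rewrite ge0_fin_numE// (le_lt_trans (u1 m))// ltry.
apply/cvgrPdist_le => q q0; have := uq q q0; apply: filterS => m.
have := u1 m; rewrite /=; case: (u m) => [x|//|//]; rewrite !lee_fin => x1 xq.
by rewrite ger0_norm/= ?subr_ge0// lerBlDl -lerBlDr.
Qed.

Lemma minimax_risk_le1 d (T : measurableType d) (H : normedModType R)
  (C : set (probability T R * H)) m r : (minimax_risk C m r <= 1%:E)%E.
Proof.
apply: ge_ereal_inf; exists (ereal_sup [set mu_ext (iid q.1 m)
  [set z | r < `|(0 : H) - q.2|] | q in C]); first by exists (fun _ _ => 0).
apply: ge_ereal_sup => _ [q _ <-].
by apply: le_trans (mu_ext_le_setT _ _) _; exact: probability_le1.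
Qed.

Lemma expR_le_inv (x : R) : x <= 20^-1 -> expR x <= 20 / 19.
Proof.
move=> x20; have e : expR x * expR (- x) = 1 by rewrite -expRD subrr expR0.
have := expR_ge1Dx (- x); have := expR_gt0 x; move: e.
move: (expR x) (expR (- x)) => y z; nra.
Qed.

Lemma geometric_small (x q : R) : 0 <= x -> x < 1 -> 0 < q ->
  exists L, forall l, (L <= l)%N -> x ^+ l < q.
Proof.
move=> x0 x1 q0; have := @cvg_expr R x; rewrite ger0_norm// => /(_ x1).
move=> /cvgr0Pnorm_lt/(_ _ q0)[L _ LP]; exists L => l Ll.
by have := LP l Ll; rewrite ger0_norm// exprn_ge0.
Qed.

(** (1 + K)^m <= exp(m K) <= (20/19)^l and 20/19 * 9/5 = 2 * 18/19. *)
Lemma risk_constants (K q : R) m l : 0 <= K -> 0 <= q -> m%:R * K <= 20^-1 * l%:R ->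
  (18 / 19) ^+ l < q ^+ 2 ->
  (1 + K) ^+ m * (9 / 5) ^+ l < #|{: {ffun 'I_l -> bool}}|%:R * q ^+ 2.
Proof.
move=> K0 q0 mK small.
have e1 : (1 + K) ^+ m <= (20 / 19) ^+ l.
  apply: le_trans (_ : expR (m%:R * K) <= _).
    by rewrite expRM_natl lerXn2r ?nnegrE ?addr_ge0 ?expR_ge0 ?expR_ge1Dx.
  apply: le_trans (_ : expR (l%:R * 20^-1) <= _).
    by rewrite ler_expR (le_trans mK)// mulrC.
  by rewrite expRM_natl lerXn2r ?nnegrE ?expR_ge0 ?divr_ge0// expR_le_inv.
rewrite card_ffun card_bool card_ord natrX.
apply: le_lt_trans (_ : (20 / 19) ^+ l * (9 / 5) ^+ l < _).
  by rewrite ler_wpM2r// exprn_ge0// divr_ge0.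
have -> : (20 / 19) ^+ l * (9 / 5) ^+ l = 2 ^+ l * (18 / 19) ^+ l :> R.
  by rewrite -!exprMn; congr (_ ^+ l); field.
by rewrite ltr_pM2l// exprn_gt0.
Qed.

Lemma perturbation_arith (x r g s C Lt : R) :
  0 <= g ^+ 2 * r ^+ 2 -> r ^+ 2 <= Lt ^+ 2 * s -> x <= 4 * r ^+ 2 * (C * s) ->
  2 * x + 2 * (g ^+ 2 * (2 * r) ^+ 4) <=
  r ^+ 2 * s * (8 * C + 32 * g ^+ 2 * Lt ^+ 2).
Proof.
move=> gr rL xC.
have : 32 * (g ^+ 2 * r ^+ 2) * r ^+ 2 <= 32 * (g ^+ 2 * r ^+ 2) * (Lt ^+ 2 * s).
  by rewrite ler_wpM2l// mulr_ge0.
lra.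
Qed.

End risk_limit.

Theorem theorem4p8 (R : realType)
  (* Polish input space, Hilbert spaces *)
  (X : completePseudoMetricType R) (hausX : hausdorff_space X)
  (sepX : separable X)
  (Y H1 H2 : hilbertType R)
  (sepY : separable Y) (sepH1 : separable H1) (sepH2 : separable H2)
  (dimY : finite_dimensional Y)
  (* kernel assumption *)
  (ev : H2 -> X -> Y) (K : X -> X -> Y -> Y) (K_ : X -> Y -> H2)
  (kerK : kernel_assumption ev K K_)
  (* the operator, the initial guess, the ball and the measure nu *)
  (D : set H1) (A : H1 -> H2) (fbar : H1)
  (delta : R) (delta0 : 0 < delta) (ballD : ball fbar delta `<=` D)
  (nu : probability (borel X) R)
  (* assumptions (i)-(iii) on A *)
  (diffA : forall f, D° f -> differentiable A f)
  (L : R) (bndA : forall h, `|'d A fbar h| <= L * `|h|)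
  (gamma : R) (gamma0 : 0 <= gamma)
  (lipA : forall f f', (D `&` ball fbar delta) f ->
    (D `&` ball fbar delta) f' ->
    exists2 e : nat -> H1, orthonormal_basis e &
      (hs_sqnorm (L2_sqnorm nu)
         (fun h => IK ev ('d A f' h - 'd A f h)%R) e
       <= ((gamma * `|f' - f|) ^+ 2)%R%:E)%E)
  (* (iv); phi is used on the spectra of the T_f, which lie in [0, a] *)
  (phi : R -> R) (phi_cont : {within `[0, +oo[, continuous phi})
  (phi_incr : {in `[0, +oo[ &, {homo phi : s t / s < t}}) (phi0 : phi 0 = 0)
  (a : R) (Top_le : forall f, ball fbar delta f ->
    forall h, `|Top ev A nu f h| <= a * `|h|)
  (Ltheta : R)
  (theta_lip : Ltheta.-lipschitz_(`[0, Num.sqrt a]) (fun t : R => phi (t ^+ 2)))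
  (Rf : H1 -> {linear H1 -> H1})
  (Rf_cont : forall f, ball fbar delta f -> continuous (Rf f))
  (zeta : R) (zeta0 : 0 < zeta)
  (phi_Top : forall f, ball fbar delta f ->
    opfun phi (Top ev A nu f) = Rf f \o opfun phi (Top ev A nu fbar))
  (Rf_near : forall f, ball fbar delta f ->
    forall h, `|Rf f h - h| <= zeta * `|f - fbar| * `|h|)
  (* (v): eigenvalue decay *)
  (alpha beta b : R) (alpha0 : 0 < alpha) (beta0 : 0 < beta) (b1 : 1 < b)
  (t : nat -> R) (eigT : eigenvalues (Top ev A nu fbar) t)
  (decay : forall n, alpha * n.+1%:R `^ (- b) <= t n <= beta * n.+1%:R `^ (- b))
  (* the class; nu is the marginal distribution of one of its members *)
  (M Sigma Rad : R) (M0 : 0 < M) (Sigma0 : 0 < Sigma) (Rad0 : 0 < Rad)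
  (nu_marginal : exists2 q, class_P ev A D fbar phi M Sigma Rad beta b q &
    forall B, measurable B -> marginal q.1 B = nu B) :
  (fun tau : R => limn_einf (fun m : nat =>
     minimax_risk (class_P ev A D fbar phi M Sigma Rad beta b) m
       (tau * phi (Psi_inv b phi (m%:R `^ (- 2^-1))))))
    @ 0^'+ --> 1%:E.

Proof.
have [e eT] := eigT.
have t0 n : 0 < t n.
  have /andP[+ _] := decay n; apply: lt_le_trans.
  by rewrite mulr_gt0// powR_gt0// ltr0n.
have bfbar : ball fbar delta fbar by exact: ballxx.
have eigLK : exists2 t', eigenvalues (LK ev nu) t' &
    forall n, t' n <= beta * n.+1%:R `^ (- b).
  have [q [_ _ _ [t' et' t'_le]] qnu] := nu_marginal.
  by exists t' => //; rewrite -(eq_LK ev qnu).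
have t_a n : t n <= a.
  have en : `|e n| = 1.
    apply/eqP; rewrite -(eqrXn2 (_ : 0 < 2)%N)// expr1n -inner_norm.
    by rewrite (eigen_orthonormal t0 eT) eqxx.
  have := Top_le _ bfbar (e n); rewrite (Top_eigen t0 eT) normrZ en !mulr1.
  by rewrite gtr0_norm.
have phi_sqr s : 0 <= s -> s <= a -> phi s ^+ 2 <= Ltheta ^+ 2 * s.
  move=> s0 sa; have a0 : 0 <= a by exact: le_trans sa.
  have := theta_lip (Num.sqrt s, 0).
  rewrite /= !in_itv/= !sqrtr_ge0 lexx ler_sqrt// sa => /(_ (conj isT isT)).
  rewrite sqr_sqrtr// expr0n/= phi0 !subr0 => le1.
  rewrite -[X in X ^+ 2 <= _]ger0_norm; last by rewrite -phi0 phi_homo.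
  apply: le_trans (_ : (Ltheta * `|Num.sqrt s|) ^+ 2 <= _).
    by rewrite lerXn2r ?nnegrE ?(le_trans _ le1).
  by rewrite exprMn real_normK ?num_real// sqr_sqrtr.
have [P0 [eta [c [eta0 c0 laws]]]] :=
  perturbed_laws (b := b) kerK sepY dimY D A fbar phi Rad M0 Sigma0 eigLK.
have DA f : ball fbar delta f -> D° f by exact: ball_interior.
have [dA dA0 Anear] : exists2 dA : R, 0 < dA &
    forall u, `|u| < dA -> `|A (fbar + u) - A fbar| <= eta.
  have /cvgrPdist_le/(_ _ eta0) := differentiable_continuous (diffA _ (DA _ bfbar)).
  move=> /nbhs_ballP[dA /= dA0 dAP]; exists dA => // u ud.
  by rewrite distrC; apply: dAP; rewrite -ball_normE /= opprD addNKr normrN.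
(* below [eps] the candidates stay in the ball, their laws in the class, and R_f - I
is at most 1/2 *)
pose eps := Num.min delta (Num.min dA (2 * zeta)^-1).
have eps0 : 0 < eps by rewrite !lt_min delta0 dA0 invr_gt0 mulr_gt0.
have [C1 [C2 [C10 C20 scal]]] := sample_size_scaling b1 phi_cont phi0 phi_incr alpha0.
pose C := beta * C1.
pose C3 := 8 * C + 32 * gamma ^+ 2 * Ltheta ^+ 2.
have Cge0 : 0 <= C by rewrite mulr_ge0 ?(ltW beta0) ?(ltW C10).
have C30 : 0 <= C3.
  by apply: addr_ge0; rewrite mulr_ge0 ?sqr_ge0// mulr_ge0 ?sqr_ge0.
pose C4 := c * C3 * C2.
have C40 : 0 <= C4 by rewrite !mulr_ge0// ltW.
(* tau <= 1 absorbs fourth powers, Rad / 4 serves the source condition, and the last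
term keeps the exponent C4 tau^2 l below l / 20 *)
pose tau0 := Num.min 1 (Num.min (Rad / 4) (20 * (C4 + 1))^-1).
have tau00 : 0 < tau0.
  by rewrite !lt_min ltr01 divr_gt0//= invr_gt0 mulr_gt0// ltr_wpDl.
apply: cvg_near_cst; near=> tau.
have tau_gt0 : 0 < tau by [].
have : tau <= tau0 by near: tau; exact: nbhs_right_le.
rewrite !le_min => /and3P[tau1 tauR tauC].
have C4tau : C4 * tau ^+ 2 <= 20^-1.
  apply: le_trans (_ : (C4 + 1) * tau <= _).
    by apply: ler_pM; rewrite ?sqr_ge0 ?lerDl// expr2 ler_piMr// ltW.
  have C41 : 0 < C4 + 1 by rewrite ltr_wpDl.
  by rewrite mulrC -ler_pdivlMr// -invfM.
apply: limn_einf_eq1 => [m|q q0]; first exact: minimax_risk_le1.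
have [lmin lminP] : exists lmin, forall l, (lmin <= l)%N -> (18 / 19 : R) ^+ l < q ^+ 2.
  by apply: geometric_small; rewrite ?divr_ge0 ?exprn_gt0//; lra.
pose eta_s := (eps / (4 * (`|Ltheta| + 1))) ^+ 2.
have L1 : 0 < `|Ltheta| + 1 by rewrite ltr_wpDl.
have eta_s0 : 0 < eta_s by rewrite exprn_gt0// divr_gt0// mulr_gt0.
apply: filterS (scal eta_s lmin eta_s0) => m /=; set s := Psi_inv _ _ _.
move=> [s0 s_eta [l [Ll l0 tge tle mle]]].
have ps : 0 < phi s by exact: phi_gt0.
set r := tau * phi s; have r0 : 0 < r by rewrite mulr_gt0.
have t_ge (i : 'I_l) : s <= t (l + i).
  have /andP[+ _] := decay (l + i)%N; apply: le_trans.
  by apply: tge; rewrite -addnn ltn_add2l.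
have t_le (i : 'I_l) : t (l + i) <= C * s.
  have /andP[_ /le_trans] := decay (l + i)%N; apply.
  by rewrite /C -mulrA ler_wpM2l ?(ltW beta0)// tle// leq_addr.
have sa : s <= a by exact: le_trans (t_ge (Ordinal l0)) (t_a _).
have phi_eps : 4 * phi s <= eps.
  rewrite mulrC -ler_pdivlMr// -(ler_pXn2r (_ : 0 < 2)%N) ?nnegrE ?(ltW ps)//; last first.
    by rewrite divr_ge0// ltW.
  apply: le_trans (phi_sqr s (ltW s0) sa) _.
  apply: le_trans (_ : Ltheta ^+ 2 * eta_s <= _); first by rewrite ler_wpM2l ?sqr_ge0.
  rewrite /eta_s -exprMn -[leLHS]real_normK ?num_real//.
  rewrite lerXn2r ?nnegrE ?divr_ge0 ?(ltW eps0)// normrM.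
  rewrite [X in _ * X]gtr0_norm ?divr_gt0 ?mulr_gt0//.
  have -> : `|Ltheta| * (eps / (4 * (`|Ltheta| + 1))) =
      `|Ltheta| / (`|Ltheta| + 1) * (eps / 4) by field; rewrite gt_eqF.
  by rewrite ler_piMl ?divr_ge0 ?(ltW eps0)// ler_pdivrMr// mul1r lerDl.
have r_le : r <= phi s by rewrite ler_piMl// ltW.
(* 2 r is the distance of the candidates to fbar *)
have r2eps : 2 * r < eps by lra.
pose f (sg : {ffun 'I_l -> bool}) := fbar + vertex e r sg.
have fE sg : f sg - fbar = vertex e r sg by rewrite /f addrAC subrr add0r.
have nv (sg : {ffun 'I_l -> bool}) : `|vertex e r sg| = 2 * r.
  exact: (norm_vertex t0 eT l0 r0 sg).
have bf sg : ball fbar delta (f sg).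
  rewrite -ball_normE /= distrC fE nv (lt_le_trans r2eps)//.
  by rewrite ge_min lexx.
pose kap := c * (r ^+ 2 * s * C3).
have kap0 : 0 <= kap by rewrite !mulr_ge0 ?sqr_ge0// ltW.
have form_le sg : inner (LK ev nu (A (f sg) - A fbar)) (A (f sg) - A fbar) <= r ^+ 2 * s * C3.
  have vd : `|vertex e r sg| < delta.
    by rewrite nv (lt_le_trans r2eps)// ge_min lexx.
  apply: le_trans (form_perturbation sepY dimY kerK delta0 ballD diffA gamma0 lipA t0 eT vd) _.
  have := form_vertex_le sepY dimY kerK t0 eT r l0 t_le sg; rewrite nv.
  have : r ^+ 2 <= Ltheta ^+ 2 * s.
    by apply: le_trans (phi_sqr s (ltW s0) sa); rewrite lerXn2r ?nnegrE ?(ltW r0) ?(ltW ps).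
  have := mulr_ge0 (sqr_ge0 gamma) (sqr_ge0 r).
  exact: perturbation_arith.
have /choice[P PP] sg : exists P, class_P ev A D fbar phi M Sigma Rad beta b (P, f sg) /\
    forall g : borel X * borel Y -> R, (forall z, 0 <= g z <= 1) -> measurable_fun setT g ->
      (\int[P]_z g z) ^+ 2 <= (1 + kap) * \int[P0]_z (g z ^+ 2).
  have [|||P [PC Psm]] := laws (f sg).
  - exact: DA.
  - apply: Anear; rewrite nv (lt_le_trans r2eps)// ge_min; apply/orP; right.
    by rewrite ge_min lexx.
  - have [g gu gle] := vertex_source sepY dimY kerK t0 eT phi0 phi_incr l0 r0 s0 t_ge sg.
    have [|||||g' g'E g'le] := @source_element _ _ (opfun phi (Top ev A nu fbar))
        (opfun phi (Top ev A nu (f sg))) (Rf (f sg)) (zeta * `|f sg - fbar|) g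
        (vertex e r sg) _ _ (Rf_near _ (bf sg)).
    + exact: opfun_symmetric.
    + exact: phi_Top.
    + by rewrite mulr_ge0// ltW.
    + rewrite fE nv -ler_pdivlMl//; apply: (le_trans (ltW r2eps)).
      by rewrite -invfM mulrC !ge_min lexx !orbT.
    + exact: gu.
    exists g'; first by rewrite fE.
    apply: (le_trans g'le); apply: le_trans (_ : 2 * (2 * r / phi s) <= _).
      by rewrite ler_wpM2l.
    have -> : 2 * (2 * r / phi s) = tau * 4 by rewrite /r; field; rewrite gt_eqF.
    by rewrite -ler_pdivlMr.
  exists P; split => // g g01 mg; apply: le_trans (Psm g g01 mg) _.
  apply: ler_wpM2r; first by apply: Rintegral_ge0 => z _; exact: sqr_ge0.
  by rewrite lerD2l ler_wpM2l// -(LK_formE sepY dimY kerK t0 eT).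
apply: (minimax_risk_ge (P := P) (f := f) (P0 := P0) (c := 1 + kap) (V := (9 / 5) ^+ l)).
- by move=> sg; case: (PP sg).
- by rewrite ltr_wpDr.
- by move=> sg; case: (PP sg).
- move=> v; set E := [set sg | _]%SET.
  have [->|[sg0]] := set_0Vmem E; first by rewrite cards0 exprn_ge0// divr_ge0.
  rewrite inE => v0; apply: le_trans (hamming_ball_card R sg0).
  rewrite ler_nat; apply: subset_leq_card; apply/fintype.subsetP => sg; rewrite !inE => vs.
  exact: (vertex_separation t0 eT l0 r0 vs v0).
- exact: ltW.
apply: risk_constants => //; first exact: ltW; last exact: lminP.
apply: le_trans (_ : C4 * tau ^+ 2 * l%:R <= _); last by rewrite ler_wpM2r.
have -> : m%:R * kap = c * C3 * tau ^+ 2 * (m%:R * phi s ^+ 2 * s).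
  by rewrite /kap /r; ring.
rewrite /C4; apply: le_trans (_ : c * C3 * tau ^+ 2 * (C2 * l%:R) <= _).
  by rewrite ler_wpM2l// !mulr_ge0// ?sqr_ge0.
by rewrite le_eqVlt; apply/orP; left; apply/eqP; ring.
Unshelve. all: by end_near. Qed.
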